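(* For any rectangular diagram of a link $R$, there exists a rectangular diagram of a surface $\Pi$ such that the following holds: (1) $R\subset\partial\Pi$; (2) whenever a rectangular diagram of a surface $\Pi'$ has the same dividing code as $\Pi$ has, the diagrams $\Pi$ and $\Pi'$ are combinatorially equivalent.
   Context: Let $\mathbb T^2=\mathbb S^1\times\mathbb S^1$ with angular coordinates $\theta,\varphi$. For distinct $x,y\in\mathbb S^1$, $[x;y]$ denotes the arc of $\mathbb S^1$ starting at $x$ and ending at $y$ with respect to the standard orientation of $\mathbb S^1$. A rectangular diagram of a link is a finite subset $R\subset\mathbb T^2$ such that every meridian $\{\theta\}\times\mathbb S^1$ and every longitude $\mathbb S^1\times\{\varphi\}$ contains either no or exactly two points of $R$, with an assignment of `$+$' or `$-$' to every point of $R$ such that two points of $R$ on the same meridian or on the same longitude have opposite signs (the signs play no role in the inclusion $R\subset\partial\Pi$). A rectangle is a subset $r\subset\mathbb T^2$ of the form $[\theta_1;\theta_2]\times[\varphi_1;\varphi_2]$; its vertices are the four points of $\{\theta_1,\theta_2\}\times\{\varphi_1,\varphi_2\}$. Two rectangles $r_1,r_2$ are compatible if one of the following holds: $r_1\cap r_2=\varnothing$; $r_1\cap r_2$ is a subset of the vertices of $r_1$ (equivalently, of $r_2$); $r_1\cap r_2$ is a rectangle disjoint from the vertices of both $r_1$ and $r_2$. A rectangular diagram of a surface is a finite collection $\Pi=\{r_1,\dots,r_k\}$ of pairwise compatible rectangles such that every meridian $\{\theta\}\times\mathbb S^1$ and every longitude $\mathbb S^1\times\{\varphi\}$ contains at most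 two free vertices, where a free vertex is a point that is a vertex of exactly one rectangle in $\Pi$. The boundary $\partial\Pi$ is the set of all free vertices of $\Pi$. On $\Pi$ define two binary relations. For $r_1,r_2\in\Pi$: $r_1\nearrow r_2$ means that $r_1=[\theta_1;\theta_2]\times[\varphi_1;\varphi_2]$ and $r_2=[\theta_2;\theta_3]\times[\varphi_2;\varphi_3]$ for some $\theta_i,\varphi_i$; $r_1\searrow r_2$ means that $r_1=[\theta_1;\theta_2]\times[\varphi_2;\varphi_3]$ and $r_2=[\theta_2;\theta_3]\times[\varphi_1;\varphi_2]$ for some $\theta_i,\varphi_i$. Two diagrams $\Pi,\Pi'$ have the same (equivalent) dividing code if there is a bijection $\Pi\to\Pi'$ that preserves the relations $\nearrow$ and $\searrow$ (in both directions). Two rectangular diagrams of a surface are combinatorially equivalent if one can be taken to the other by a homeomorphism $\mathbb T^2\to\mathbb T^2$ of the form $f\times g$, where $f$ and $g$ are orientation-preserving homeomorphisms of $\mathbb S^1$. *)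

(* Defs.v *)
From HB Require Import structures.
From mathcomp Require Import all_boot all_order all_algebra.
From mathcomp Require Import all_classical all_reals all_analysis.

Set Implicit Arguments.
Unset Strict Implicit.
Unset Printing Implicit Defensive.

Import Order.TTheory GRing.Theory Num.Theory.
Import numFieldNormedType.Exports.

Local Open Scope classical_set_scope.
Local Open Scope card_scope.
Local Open Scope ring_scope.

(* The circle S^1 = R/Z, with the quotient topology. *)

Definition int_congr (R : realType) (x y : R) : bool := x - y \is a Num.int.

Lemma int_congr_refl (R : realType) : reflexive (@int_congr R).
Proof. by move=> x; rewrite /int_congr subrr rpred0. Qed.

Lemma int_congr_sym (R : realType) : symmetric (@int_congr R).
Proof. by move=> x y; rewrite /int_congr -opprB rpredN. Qed.

Lemma int_congr_trans (R : realType) : transitive (@int_congr R).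
Proof.
by move=> y x z xy yz; rewrite /int_congr -(subrKA y) rpredD.
Qed.

Canonical int_congr_equiv (R : realType) : equiv_rel R :=
  EquivRel (@int_congr R) (@int_congr_refl R) (@int_congr_sym R)
    (@int_congr_trans R).

Definition circle (R : realType) : Type :=
  quotient_topology {eq_quot (int_congr_equiv R)}%qT.

HB.instance Definition _ (R : realType) := Topological.copy (circle R)
  (quotient_topology {eq_quot (int_congr_equiv R)}%qT).
HB.instance Definition _ (R : realType) := Quotient.copy (circle R)
  (quotient_topology {eq_quot (int_congr_equiv R)}%qT).

Notation torus R := (circle R * circle R)%type.

Definition to_circle (R : realType) (t : R) : circle R := (\pi_(circle R) t)%qT.

Section rectangles.
Context {R : realType}.
Implicit Types (x y t : circle R) (p : torus R) (r : set (torus R)).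

(* [x; y], traversed in the direction of increasing angle; it is only used for
   x <> y. *)
Definition arc x y : set (circle R) :=
  [set z | exists a b c : R,
    [/\ to_circle a = x, to_circle b = y, to_circle c = z
      & [/\ a <= c, c <= b & b < a + 1]]].

Definition meridian t : set (torus R) := [set t] `*` setT.

Definition longitude t : set (torus R) := setT `*` [set t].

Definition rectangle_at x1 x2 y1 y2 r : Prop :=
  [/\ x1 <> x2, y1 <> y2 & r = arc x1 x2 `*` arc y1 y2].

Definition is_rectangle r : Prop :=
  exists x1 x2 y1 y2, rectangle_at x1 x2 y1 y2 r.

(* The corners x1, x2, y1, y2 are determined by the set r. *)
Definition vertices r : set (torus R) :=
  [set p | exists x1 x2 y1 y2,
    rectangle_at x1 x2 y1 y2 r /\ ([set x1; x2] `*` [set y1; y2]) p].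

Definition compatible r1 r2 : Prop :=
  [\/ r1 `&` r2 = set0,
      r1 `&` r2 `<=` vertices r1
    | [/\ is_rectangle (r1 `&` r2),
          (r1 `&` r2) `&` vertices r1 = set0
        & (r1 `&` r2) `&` vertices r2 = set0]].

Definition nearrow r1 r2 : Prop :=
  exists x1 x2 x3 y1 y2 y3,
    rectangle_at x1 x2 y1 y2 r1 /\ rectangle_at x2 x3 y2 y3 r2.

Definition searrow r1 r2 : Prop :=
  exists x1 x2 x3 y1 y2 y3,
    rectangle_at x1 x2 y2 y3 r1 /\ rectangle_at x2 x3 y1 y2 r2.

End rectangles.

Section diagrams.
Context {R : realType}.
Implicit Types (L : set (torus R)) (P : set (set (torus R))).

(* [sgn p = true] stands for the sign '+'; the values of [sgn] outside L are
   irrelevant. *)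
Definition is_link_diagram L (sgn : torus R -> bool) : Prop :=
  [/\ finite_set L,
      forall t, meridian t `&` L = set0 \/ meridian t `&` L #= `I_2,
      forall t, longitude t `&` L = set0 \/ longitude t `&` L #= `I_2
    & forall p q, L p -> L q -> p <> q -> p.1 = q.1 \/ p.2 = q.2 ->
        sgn p <> sgn q].

(* The boundary of P: the set of its free vertices. *)
Definition boundary P : set (torus R) :=
  [set p | exists! r, P r /\ vertices r p].

Definition is_surface_diagram P : Prop :=
  [/\ finite_set P,
      forall r, P r -> is_rectangle r,
      forall r1 r2, P r1 -> P r2 -> r1 <> r2 -> compatible r1 r2,
      forall t, meridian t `&` boundary P #<= `I_2
    & forall t, longitude t `&` boundary P #<= `I_2].

Definition same_dividing_code P P' : Prop :=
  exists b : set (torus R) -> set (torus R),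
    [/\ set_bij P P' b,
        forall r1 r2, P r1 -> P r2 -> (nearrow r1 r2 <-> nearrow (b r1) (b r2))
      & forall r1 r2, P r1 -> P r2 -> (searrow r1 r2 <-> searrow (b r1) (b r2))].

Definition homeomorphism (f : circle R -> circle R) : Prop :=
  continuous f /\
  exists g : circle R -> circle R, [/\ continuous g, cancel f g & cancel g f].

(* Orientation-preserving homeomorphism of R/Z: one that lifts to a continuous
   increasing map of the universal cover R. *)
Definition orientation_preserving_homeo (f : circle R -> circle R) : Prop :=
  homeomorphism f /\
  exists F : R -> R,
    [/\ continuous F, {homo F : s t / s < t}
      & forall s, f (to_circle s) = to_circle (F s)].

Definition combinatorially_equivalent P P' : Prop :=
  exists f g : circle R -> circle R,
    [/\ orientation_preserving_homeo f, orientation_preserving_homeo g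
      & [set (fun p : torus R => (f p.1, g p.2)) @` r | r in P] = P'].

End diagrams.

(* Main.v *)
Require Import Defs.
From mathcomp Require Import all_boot all_order all_algebra.
From mathcomp Require Import all_classical all_reals all_analysis.
From mathcomp Require Import finmap zify lra.
(* after the libraries, so that [arc] is an arc of the circle *)
Import Defs.

Set Implicit Arguments.
Unset Strict Implicit.
Unset Printing Implicit Defensive.

Import Order.TTheory GRing.Theory Num.Theory.
Import numFieldNormedType.Exports.

Local Open Scope classical_set_scope.
Local Open Scope card_scope.
Local Open Scope ring_scope.

(** Rectangles of a surface diagram that have a side on a common longitude do not
    overlap along it: a vertex of one that lies on the other is a vertex of both
    ([compatible_vertex]). So if rectangles r_0, ..., r_{N-1} with sides on one
    longitude form a closed chain, each touching the next at a corner, then the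
    chain winds around the longitude exactly once ([chain_turns_once]), and the
    cyclic order of its corners is known. Touching at a corner is what the
    dividing code records. Hence a diagram is determined by its code up to
    combinatorial equivalence as soon as

    - some longitude carries a closed chain through all occupied meridians, and
      some meridian a closed chain through all occupied longitudes;
    - the sides of all other rectangles can be traced back to these two chains
      by following common corners.

    It remains to find such a diagram with the link [L] in its boundary. Cut the
    torus along a meridian and a longitude that miss [L], let [L] occupy the columns
    1, ..., n and the rows 1, ..., m of the resulting square, and replace each
    column i by two close meridians 2i, 2i + 1 and each row j by two close
    longitudes 2j, 2j + 1. The meridians 0, 1 and the longitudes 0, 1 bound two
    walls along the cut. Column i contains two points of [L], in the rows
    low i < high i; take the strip between the meridians 2i and 2i + 1, from the
    upper point up to the cut, and from the wall up to the lower point, and do the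
    same with rows. A vertical strip and a horizontal strip are disjoint, or they
    cross, or they end at the same point of [L] and touch there at one corner.
    Every second square of the two walls completes the strips to closed chains
    along the longitude 0 and the meridian 0 ([piece]).

    Near a point of [L] in column i and row j, the strips that end there have
    three of the four points {2i, 2i + 1} x {2j, 2j + 1} as vertices: one of them
    is common to both, and the two points adjacent to it are free vertices.
    So each meridian 2i, 2i + 1 has exactly two free vertices, and there are no
    free vertices elsewhere ([corner_shared_or_free]). To have [L] among them, one
    must choose for each column one of its two meridians, and for each row one of
    its two longitudes, in such a way that at each point of [L] the choices
    select a free vertex. The signs of the link do this: they alternate along
    [L], so it is enough to let the sign of the lowest point of a column and the
    sign of the leftmost point of a row decide. *)

(** * The circle as R/Z *)

Section circle.
Context {R : realType}.
Implicit Types (a b c s t : R) (x y z : circle R).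

Lemma to_circle_eqP s t :
  to_circle s = to_circle t <-> exists m : int, s = t + m%:~R.
Proof.
split=> [/eqquotP /= | [m ->]].
  by rewrite /int_congr => /intrP[m st]; exists m; rewrite -st addrC subrK.
apply/eqquotP; by rewrite /= /int_congr [t + _]addrC addrK intr_int.
Qed.

Lemma to_circleD1 s : to_circle (s + 1) = to_circle s.
Proof. by apply/to_circle_eqP; exists 1. Qed.

Lemma to_circle_inj a s t : a <= s -> a <= t -> s < a + 1 -> t < a + 1 ->
  to_circle s = to_circle t -> s = t.
Proof.
move=> as_ at_ sa ta /to_circle_eqP[m st].
have m1 : (m < 1) by rewrite -(ltr_int R) /=; lra.
have m2 : (-1 < m) by rewrite -(ltr_int R) /=; lra.
have m0 : m = 0.
  by move: m1 m2; clear; lia.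
by rewrite st m0 mulr0z addr0.
Qed.

Lemma lift_circle a x : exists2 t, to_circle t = x & a <= t < a + 1.
Proof.
have [s <-] : exists s, to_circle s = x.
  by exists (repr x); rewrite /to_circle reprK.
exists (s - (Num.floor (s - a))%:~R).
  by apply/to_circle_eqP; exists (- Num.floor (s - a)); rewrite intrN.
have := Num.Theory.floor_le (s - a); have := Num.Theory.lt_succ_floor (s - a).
rewrite intrD; lra.
Qed.

(** * Arcs *)

Lemma lift_arc x y : x <> y ->
  exists a b, [/\ to_circle a = x, to_circle b = y, a < b & b < a + 1].
Proof.
have [a <- _] := lift_circle 0 x; have [b <- /andP[ab ba]] := lift_circle a y.
exists a, b; split=> //; rewrite lt_neqAle ab andbT.
by apply/eqP => eab; apply: H; rewrite eab.
Qed.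

Lemma arcE a b : a < b -> b < a + 1 ->
  arc (to_circle a) (to_circle b) = @to_circle R @` [set t | a <= t <= b].
Proof.
move=> ab ba; apply/seteqP; split=> [z|z /= [t /andP[at_ tb] <-]]; last first.
  by exists a, b, t.
move=> [a' [b' [c [/to_circle_eqP[m am] /to_circle_eqP[k bk] <-]]]] [ac cb ba'].
have km : k = m.
  have : k < m + 1 by rewrite -(ltr_int R) intrD; lra.
  have : m - 1 < k by rewrite -(ltr_int R) intrB; lra.
  by clear; lia.
rewrite {k}km in bk.
exists (c - m%:~R); last by apply/to_circle_eqP; exists (- m); rewrite intrN.
by rewrite /=; lra.
Qed.

Lemma arc_in a b t : a < b -> b < a + 1 -> a <= t < a + 1 ->
  arc (to_circle a) (to_circle b) (to_circle t) <-> t <= b.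
Proof.
move=> ab ba /andP[a_t ta]; rewrite arcE//; split=> [[s /= /andP[as_ sb] st]|tb].
  by rewrite -(@to_circle_inj a s t)//; lra.
by exists t => //=; rewrite a_t.
Qed.

Lemma arc_start x y : x <> y -> arc x y x.
Proof.
move=> /lift_arc[a [b [<- <- ab ba]]].
by apply/(arc_in ab ba); lra.
Qed.

Lemma arc_end x y : x <> y -> arc x y y.
Proof.
move=> /lift_arc[a [b [<- <- ab ba]]].
by apply/(arc_in ab ba); lra.
Qed.

Lemma arc_midpoint x y : x <> y -> exists z, [/\ arc x y z, z <> x & z <> y].
Proof.
move=> /lift_arc[a [b [<- <- ab ba]]].
exists (to_circle ((a + b) / 2)); split.
- by apply/(arc_in ab ba); lra.
- by move=> /(@to_circle_inj a); lra.
- by move=> /(@to_circle_inj a); lra.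
Qed.

(** An arc determines its endpoints: were the start of one an inner point of
    the other, then the two arcs would cover the whole circle. *)
Lemma arc_inj x y x' y' : x <> y -> x' <> y' -> arc x y = arc x' y' ->
  x = x' /\ y = y'.
Proof.
move=> xy xy' eA; have [a [b [ax bE ab ba]]] := lift_arc xy.
have [a' a'E aa'] := lift_circle a x'; have [b' b'E ab'] := lift_circle a' y'.
have {}ab' : a' < b' < a' + 1.
  case/andP: ab' => ab' ->; rewrite andbT lt_neqAle ab' andbT.
  by apply/eqP => e; apply: xy'; rewrite -a'E -b'E e.
have /andP[{}ab' ba'] := ab'; move: xy xy' eA.
rewrite -ax -bE -a'E -b'E => xy xy' eA.
have a'b : a' <= b by apply/(arc_in ab ba aa'); rewrite eA; exact: arc_start.
have aE : a' = a.
  have : arc (to_circle a') (to_circle b') (to_circle a).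
    by rewrite -eA; exact: arc_start.
  rewrite arcE// => -[t /= /andP[at_ tb]] /to_circle_eqP[m tm].
  have [|m1] := ltP m 1.
    have [m0|m0] := ltP m 0.
      have : m <= -1 by move: m0; clear; lia.
      by rewrite -(ler_int R); lra.
    move=> m1; have m00 : m = 0 by move: m0 m1; clear; lia.
    by rewrite m00 mulr0z addr0 in tm; lra.
  rewrite -(ler_int R) in m1.
  pose s := (b + a + 1) / 2.
  have : arc (to_circle a) (to_circle b) (to_circle s).
    by rewrite eA; apply/(arc_in ab' ba'); rewrite /s; lra.
  by move/(arc_in ab ba); rewrite /s; lra.
rewrite {a' ax a'E aa' a'b xy'}aE in eA ab' ba' b'E *; split=> //; congr to_circle.
apply/eqP; rewrite eq_le; apply/andP; split.
  by apply/(arc_in ab' ba'); [lra|rewrite -eA; exact: arc_end].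
apply/(arc_in ab ba); [lra|rewrite eA; apply: arc_end].
by move/(@to_circle_inj a); lra.
Qed.
End circle.

(** * Homeomorphisms of the circle *)

Section lifted_homeo.
Context {R : realType}.
Implicit Types (F G : R -> R) (s t : R).

(** The preimage of an open interval is the open interval between the images of
    its endpoints under the inverse. *)
Lemma increasing_bijection_continuous F G :
  {homo F : s t / s < t} -> {homo G : s t / s < t} ->
  cancel F G -> cancel G F -> continuous F.
Proof.
move=> Fmono Gmono FK GK x.
apply/cvgrPdist_lt => e e0.
have : x \in `](G (F x - e)), (G (F x + e))[.
  by rewrite in_itv /= -{2 3}(FK x) !Gmono//; lra.
move=> /near_in_itvoo; apply: filterS => t; rewrite in_itv /= => /andP[+ +].
move=> /Fmono + /Fmono; rewrite !GK ltr_distl; lra.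
Qed.

Lemma circle_map_of_lift F : (forall s, F (s + 1) = F s + 1) ->
  exists f : circle R -> circle R, forall s, f (to_circle s) = to_circle (F s).
Proof.
move=> F1; exists (fun x => to_circle (F (repr x))) => s.
have /to_circle_eqP[m ->] : to_circle (repr (to_circle s)) = to_circle s.
  by rewrite /to_circle reprK.
have Fn (n : nat) t : F (t + n%:R) = F t + n%:R.
  by elim: n => [|n IH]; rewrite ?addr0// -natr1 !addrA F1 IH.
apply/to_circle_eqP; exists m; case: m => n; first exact: Fn.
have := Fn n.+1 (s - n.+1%:R); rewrite subrK NegzE mulrNz => ->.
by rewrite addrK.
Qed.

Lemma homeo_of_lift F G :
  {homo F : s t / s < t} -> {homo G : s t / s < t} ->
  cancel F G -> cancel G F -> (forall s, F (s + 1) = F s + 1) ->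
  exists f : circle R -> circle R, orientation_preserving_homeo f /\
    forall s, f (to_circle s) = to_circle (F s).
Proof.
move=> Fmono Gmono FK GK F1.
have G1 s : G (s + 1) = G s + 1 by rewrite -{1}(GK s) -F1 FK.
have [f fE] := circle_map_of_lift F1; have [g gE] := circle_map_of_lift G1.
have surj x : exists s, to_circle s = x by have [s <-] := lift_circle 0 x; exists s.
have cont F' f' : continuous F' ->
  (forall s, f' (to_circle s) = to_circle (F' s)) ->
    continuous (f' : circle R -> circle R).
  move=> F'c f'E; apply/quotient_continuous.
  rewrite (_ : f' \o _ = @to_circle R \o F'); last by apply/funext => s; exact: f'E.
  move=> s; apply: continuous_comp; [exact: F'c|exact: pi_continuous].
have Fc := increasing_bijection_continuous Fmono Gmono FK GK.
have Gc := increasing_bijection_continuous Gmono Fmono GK FK.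
exists f; split=> //; split; last by exists F.
split; first exact: (cont F).
exists g; split; first exact: (cont G).
- by move=> x; have [s <-] := surj x; rewrite fE gE FK.
- by move=> x; have [s <-] := surj x; rewrite gE fE GK.
Qed.

Lemma image_arc F G f x y :
  {homo F : s t / s < t} -> {homo G : s t / s < t} ->
  cancel F G -> cancel G F -> (forall s, F (s + 1) = F s + 1) ->
  (forall s, f (to_circle s) = to_circle (F s)) ->
  x <> y -> f @` arc x y = arc (f x) (f y).
Proof.
move=> Fmono Gmono FK GK F1 fE /lift_arc[a [b [<- <- ab ba]]].
have Fle := ltW_homo Fmono; have Gle := ltW_homo Gmono.
rewrite !fE !arcE//; [|exact: Fmono|by rewrite -F1 Fmono].
rewrite image_comp; apply/seteqP;
  split=> [_ [t /= /andP[at_ tb] <-]|_ [t /= /andP[at_ tb] <-]].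
  by exists (F t); rewrite /= ?fE// !Fle.
exists (G t); last by rewrite /= fE GK.
by rewrite /= -[a]FK -[b]FK !Gle.
Qed.

End lifted_homeo.

Section piecewise_linear.
Context {R : realType}.
Implicit Types (s t l : R) (u v : nat -> R).

(** The graph of the map which commutes with the translation by 1, sends every
    [u i] to [v i], and is affine in between. Given as a relation, it is visibly
    symmetric in [u] and [v], so that it is only necessary to prove that it is
    total and increasing. *)
Definition interpolation N u v s t := exists (i : nat) (m : int) (l : R),
  [/\ (i < N)%N, 0 <= l < 1, s = u i + l * (u i.+1 - u i) + m%:~R
    & t = v i + l * (v i.+1 - v i) + m%:~R].

(** [u 0 < ... < u N] are lifts of N points of the circle in their cyclic order,
    the last being the first one again. *)
Definition turn_once N u := (forall i, (i < N)%N ->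
  u i < u i.+1) /\ u N = u 0%N + 1.

Lemma interpolation_sym N u v s t :
  interpolation N u v s t -> interpolation N v u t s.
Proof. by move=> [i [m [l [iN l01 -> ->]]]]; exists i, m, l. Qed.

Lemma interpolation_total N u v s : turn_once N u ->
  exists t, interpolation N u v s t.
Proof.
move=> [u_mono uN].
pose m := Num.floor (s - u 0%N); pose s' := s - m%:~R.
have /andP[s'0 s'1] : u 0%N <= s' < u N.
  have := Num.Theory.floor_itv (s - u 0%N); rewrite -/m intrD uN /s'.
  by move=> /andP[*]; lra.
have [i iN /andP[ui iu]] : exists2 i, (i < N)%N & u i <= s' < u i.+1.
  elim: N s'1 {u_mono uN} => [|k IH] sk; first by lra.
  have [sk'|sk'] := ltP s' (u k); last by exists k; rewrite // sk' sk.
  by have [i ik si] := IH sk'; exists i => //; exact: ltnW.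
pose l := (s' - u i) / (u i.+1 - u i).
have d0 : 0 < u i.+1 - u i by lra.
exists (v i + l * (v i.+1 - v i) + m%:~R), i, m, l; split=> //.
  by rewrite divr_ge0 ?ltr_pdivrMr//; lra.
by rewrite divfK ?gt_eqF// /s'; lra.
Qed.

Lemma turn_once_le N u i j : turn_once N u -> (i <= j)%N -> (j <= N)%N ->
  u i <= u j.
Proof.
move=> [u_mono _]; elim: j => [|j IH]; first by rewrite leqn0 => /eqP->.
rewrite leq_eqVlt => /predU1P[->//|ij jN].
by apply: le_trans (IH ij (ltnW jN)) _; exact/ltW/u_mono.
Qed.

(** Monotonicity comes from the fact that the triple (m, i, l) in lexicographic
    order is the order of the line, whichever the marks are. *)
Lemma interpolation_lex N u i j (m n : int) k l : turn_once N u ->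
  (i < N)%N -> (j < N)%N -> 0 <= k < 1 -> 0 <= l < 1 ->
  m < n \/ (m = n /\ ((i < j)%N \/ (i = j /\ k < l))) ->
  u i + k * (u i.+1 - u i) + m%:~R < u j + l * (u j.+1 - u j) + n%:~R.
Proof.
move=> tu iN jN /andP[k0 k1] /andP[l0 l1] lex.
have [u_mono uN] := tu.
have iu : u i + k * (u i.+1 - u i) < u i.+1 by have := u_mono i iN; nra.
have uj : u j <= u j + l * (u j.+1 - u j) by have := u_mono j jN; nra.
case: lex => [mn|[<- [ij|[<- kl]]]].
- have : m + 1 <= n by move: mn; clear; lia.
  rewrite -(ler_int R) intrD.
  have := turn_once_le tu (leq0n j) (ltnW jN).
  by have := turn_once_le tu iN (leqnn N); lra.
- by have := turn_once_le tu ij (ltnW jN); lra.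
- by have := u_mono i iN; nra.
Qed.

Lemma interpolation_mono N u v s t s' t' : turn_once N u -> turn_once N v ->
  interpolation N u v s t -> interpolation N u v s' t' -> s < s' -> t < t'.
Proof.
move=> tu tv [i [m [k [iN k01 sE tE]]]] [j [n [l [jN l01 s'E t'E]]]] ss'.
have [lex|[lex|[mn ij kl]]] : let lex (m n : int) i j (k l : R) :=
    m < n \/ (m = n /\ ((i < j)%N \/ (i = j /\ k < l))) in
    lex m n i j k l \/ (lex n m j i l k \/ [/\ m = n, i = j & k = l]).
- move=> lex; rewrite /lex.
  case: (ltgtP m n) => [?|?|->]; [by left; left|by right; left; left|].
  case: (ltngtP i j) => [?|?|->]; [by left; right; split; auto|by right; left;
    right; split; auto|].
  by case: (ltgtP k l) => [?|?|->]; [left|right; left|right; right] => //; right;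
    split; auto.
- by rewrite tE t'E; exact: interpolation_lex tv iN jN k01 l01 lex.
- have := interpolation_lex tu jN iN l01 k01 lex; rewrite -sE -s'E; lra.
- by move: ss'; rewrite sE s'E mn ij kl ltxx.
Qed.

Lemma exists_homeo_through N u v : (0 < N)%N -> turn_once N u -> turn_once N v ->
  exists f : circle R -> circle R, [/\ orientation_preserving_homeo f,
    forall i, (i <= N)%N -> f (to_circle (u i)) = to_circle (v i)
  & forall x y, x <> y -> f @` arc x y = arc (f x) (f y)].
Proof.
move=> N0 tu tv.
have [F FP] := choice (fun s => interpolation_total v s tu).
have [G GP] := choice (fun s => interpolation_total u s tv).
have Fmono : {homo F : s t / s < t}.
  by move=> s t; exact: interpolation_mono (FP s) (FP t).
have Gmono : {homo G : s t / s < t}.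
  by move=> s t; exact: interpolation_mono (GP s) (GP t).
have functional u' v' s t t' : turn_once N u' -> turn_once N v' ->
    interpolation N u' v' s t -> interpolation N u' v' s t' -> t = t'.
  move=> tu' tv' st st'; case: (ltgtP t t') => // tt'.
    by have := interpolation_mono tv' tu' (interpolation_sym st)
      (interpolation_sym st') tt'; rewrite ltxx.
  by have := interpolation_mono tv' tu' (interpolation_sym st')
    (interpolation_sym st) tt'; rewrite ltxx.
have FK : cancel F G.
  by move=> s; apply: (functional v u (F s)) => //; exact: interpolation_sym.
have GK : cancel G F.
  by move=> s; apply: (functional u v (G s)) => //; exact: interpolation_sym.
have F1 s : F (s + 1) = F s + 1.
  apply: (functional u v (s + 1)) => //.
  have [i [m [l [iN l01 sE tE]]]] := FP s.
  by exists i, (m + 1), l; split=> //; rewrite intrD addrA -?sE -?tE.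
have [f [fh fE]] := homeo_of_lift Fmono Gmono FK GK F1.
exists f; split=> // [i|x y]; last exact: (image_arc Fmono Gmono FK GK F1 fE).
have fE_lt k : (k < N)%N -> f (to_circle (u k)) = to_circle (v k).
  move=> kN; rewrite fE; congr to_circle; apply: (functional u v (u k)) => //.
  by exists k, 0, 0; rewrite kN lexx ltr01 !mul0r !addr0.
rewrite leq_eqVlt => /predU1P[->|]; last exact: fE_lt.
by rewrite tu.2 tv.2 !to_circleD1 fE_lt.
Qed.

End piecewise_linear.

(** * Sides and corners of rectangles *)

Section sides.
Context {R : realType}.
Implicit Types (x y : circle R) (p : torus R) (r : set (torus R)).

(** The sides are functions of the set [r], so that the relations of the dividing
    code become equations between sides. *)
Definition west r := xget (to_circle (0 : R))
  [set x | exists x2 y1 y2, rectangle_at x x2 y1 y2 r].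
Definition east r := xget (to_circle (0 : R))
  [set x | exists x1 y1 y2, rectangle_at x1 x y1 y2 r].
Definition south r := xget (to_circle (0 : R))
  [set y | exists x1 x2 y2, rectangle_at x1 x2 y y2 r].
Definition north r := xget (to_circle (0 : R))
  [set y | exists x1 x2 y1, rectangle_at x1 x2 y1 y r].

Lemma rectangle_at_inj x1 x2 y1 y2 x1' x2' y1' y2' r :
  rectangle_at x1 x2 y1 y2 r -> rectangle_at x1' x2' y1' y2' r ->
  [/\ x1 = x1', x2 = x2', y1 = y1' & y2 = y2'].
Proof.
move=> [nx ny ->] [nx' ny' rE].
have [eX eY] : arc x1 x2 = arc x1' x2' /\ arc y1 y2 = arc y1' y2'.
  split; apply/seteqP; split=> z az.
  - have : (arc x1 x2 `*` arc y1 y2) (z, y1) by split => //; exact: arc_start.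
    by rewrite rE => -[].
  - have : (arc x1' x2' `*` arc y1' y2') (z, y1') by split => //; exact: arc_start.
    by rewrite -rE => -[].
  - have : (arc x1 x2 `*` arc y1 y2) (x1, z) by split => //; exact: arc_start.
    by rewrite rE => -[].
  - have : (arc x1' x2' `*` arc y1' y2') (x1', z) by split => //; exact: arc_start.
    by rewrite -rE => -[].
by have [-> ->] := arc_inj nx nx' eX; have [-> ->] := arc_inj ny ny' eY.
Qed.

Lemma sidesE x1 x2 y1 y2 r : rectangle_at x1 x2 y1 y2 r ->
  [/\ west r = x1, east r = x2, south r = y1 & north r = y2].
Proof.
move=> rr; split.
- rewrite /west; case: xgetP => [x -> /= [? [? [? r']]]|/(_ x1)/= []].
    by have [] := rectangle_at_inj r' rr.
  by exists x2, y1, y2.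
- rewrite /east; case: xgetP => [x -> /= [? [? [? r']]]|/(_ x2)/= []].
    by have [] := rectangle_at_inj r' rr.
  by exists x1, y1, y2.
- rewrite /south; case: xgetP => [x -> /= [? [? [? r']]]|/(_ y1)/= []].
    by have [] := rectangle_at_inj r' rr.
  by exists x1, x2, y2.
- rewrite /north; case: xgetP => [x -> /= [? [? [? r']]]|/(_ y2)/= []].
    by have [] := rectangle_at_inj r' rr.
  by exists x1, x2, y1.
Qed.

Lemma is_rectangleP r :
  is_rectangle r <-> rectangle_at (west r) (east r) (south r) (north r) r.
Proof.
split=> [[x1 [x2 [y1 [y2 rr]]]]|rr];
  last by exists (west r), (east r), (south r), (north r).
by have [-> -> -> ->] := sidesE rr.
Qed.

Lemma nearrowE r1 r2 : is_rectangle r1 -> is_rectangle r2 ->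
  nearrow r1 r2 <-> east r1 = west r2 /\ north r1 = south r2.
Proof.
move=> /is_rectangleP rr1 /is_rectangleP rr2; split.
  move=> [x1 [x2 [x3 [y1 [y2 [y3 [h1 h2]]]]]]].
  by have [_ -> _ ->] := sidesE h1; have [-> _ -> _] := sidesE h2.
move=> [ex ey]; exists (west r1), (east r1), (east r2), (south r1), (north r1),
  (north r2).
by split=> //; rewrite ex ey.
Qed.

Lemma searrowE r1 r2 : is_rectangle r1 -> is_rectangle r2 ->
  searrow r1 r2 <-> east r1 = west r2 /\ south r1 = north r2.
Proof.
move=> /is_rectangleP rr1 /is_rectangleP rr2; split.
  move=> [x1 [x2 [x3 [y1 [y2 [y3 [h1 h2]]]]]]].
  by have [_ -> -> _] := sidesE h1; have [-> _ _ ->] := sidesE h2.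
move=> [ex ey]; exists (west r1), (east r1), (east r2), (south r2), (north r2),
  (north r1).
by split; [rewrite -ey|rewrite ex].
Qed.

Lemma verticesE x1 x2 y1 y2 r : rectangle_at x1 x2 y1 y2 r ->
  vertices r = [set x1; x2] `*` [set y1; y2].
Proof.
move=> rr; apply/seteqP; split=> [p [x1' [x2' [y1' [y2' [rr' rp]]]]]|p rp].
  by have [-> -> -> ->] := rectangle_at_inj rr rr'.
by exists x1, x2, y1, y2.
Qed.

Lemma sub_vertices r : is_rectangle r -> vertices r `<=` r.
Proof.
move=> [x1 [x2 [y1 [y2 rr]]]]; rewrite (verticesE rr).
have [nx ny ->] := rr.
by move=> [x y] /= [[] /= -> [] /= ->]; split=> /=;
  do [exact: arc_start | exact: arc_end].
Qed.

(** Rectangles that cross avoid each other's vertices. *)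
Lemma compatible_vertex r1 r2 p : is_rectangle r2 -> compatible r1 r2 ->
  r1 p -> vertices r2 p -> vertices r1 p.
Proof.
move=> rr2 + r1p vp; have r2p := sub_vertices rr2 vp.
case=> [r12|r12|[_ _ r12]].
- by have : (r1 `&` r2) p by []; rewrite r12.
- exact: r12.
- by have : (r1 `&` r2 `&` vertices r2) p by []; rewrite r12.
Qed.

End sides.

(** * Cyclic chains of arcs *)

Section chains.
Context {R : realType}.
Implicit Types (x y : circle R) (r : set (torus R)).

(** On the common longitude [y], the western end of [r2] is a vertex, so it is no
    inner point of [r1]. The sides do not coincide either: their midpoint would
    be a common point but not a vertex, and their ends exclude a crossing. *)
Lemma longitude_arcs r1 r2 y : is_rectangle r1 -> is_rectangle r2 ->
  compatible r1 r2 -> y = south r1 \/ y = north r1 ->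
    y = south r2 \/ y = north r2 ->
  (arc (west r1) (east r1) (west r2) -> west r2 = west r1 \/ west r2 = east r1)
  /\ ~ (west r1 = west r2 /\ east r1 = east r2).
Proof.
move=> rr1 rr2 cpt yr1 yr2.
have h1 := rr1; have h2 := rr2; move: h1 h2 => /is_rectangleP h1 /is_rectangleP h2.
have v1 := verticesE h1; have v2 := verticesE h2.
have [nx1 ny1 r1E] := h1; have [nx2 ny2 r2E] := h2.
have y1 : arc (south r1) (north r1) y.
  by case: yr1 => ->; [exact: arc_start|exact: arc_end].
have vertex1 x : arc (west r1) (east r1) x -> x = west r2 \/ x = east r2 ->
    vertices r1 (x, y).
  move=> ax xr2; apply: (compatible_vertex rr2 cpt); first by rewrite r1E.
  by rewrite v2.
split=> [ax|[ew ee]].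
  by have := vertex1 _ ax; rewrite v1 => -[]; auto.
have [z [az zw ze]] := arc_midpoint nx1.
suff : vertices r1 (z, y) by rewrite v1 => -[[]].
have inter x : arc (west r1) (east r1) x -> (r1 `&` r2) (x, y).
  move=> ax; split; first by rewrite r1E.
  rewrite r2E; split; first by rewrite /= -ew -ee.
  by case: yr2 => ->; [exact: arc_start|exact: arc_end].
case: cpt => [r12|r12|[_ _ r12]].
- by have := inter z az; rewrite r12.
- by apply: r12; exact: inter.
- have : (r1 `&` r2 `&` vertices r2) (west r1, y).
    split; first by apply: inter; exact: arc_start.
    by rewrite v2; split=> //; left.
  by rewrite r12.
Qed.

(** [longitude_arcs] with the two factors exchanged. *)
Lemma meridian_arcs r1 r2 x : is_rectangle r1 -> is_rectangle r2 ->
  compatible r1 r2 -> x = west r1 \/ x = east r1 -> x = west r2 \/ x = east r2 ->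
  (arc (south r1) (north r1) (south r2) ->
    south r2 = south r1 \/ south r2 = north r1)
  /\ ~ (south r1 = south r2 /\ north r1 = north r2).
Proof.
move=> rr1 rr2 cpt xr1 xr2.
have h1 := rr1; have h2 := rr2; move: h1 h2 => /is_rectangleP h1 /is_rectangleP h2.
have v1 := verticesE h1; have v2 := verticesE h2.
have [nx1 ny1 r1E] := h1; have [nx2 ny2 r2E] := h2.
have x1 : arc (west r1) (east r1) x.
  by case: xr1 => ->; [exact: arc_start|exact: arc_end].
have vertex1 y : arc (south r1) (north r1) y -> y = south r2 \/ y = north r2 ->
    vertices r1 (x, y).
  move=> ay yr2; apply: (compatible_vertex rr2 cpt); first by rewrite r1E.
  by rewrite v2.
split=> [ay|[es en]].
  by have := vertex1 _ ay; rewrite v1 => -[]; auto.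
have [z [az zs zn]] := arc_midpoint ny1.
suff : vertices r1 (x, z) by rewrite v1 => -[_ []].
have inter y : arc (south r1) (north r1) y -> (r1 `&` r2) (x, y).
  move=> ay; split; first by rewrite r1E.
  rewrite r2E; split; last by rewrite /= -es -en.
  by case: xr2 => ->; [exact: arc_start|exact: arc_end].
case: cpt => [r12|r12|[_ _ r12]].
- by have := inter z az; rewrite r12.
- by apply: r12; exact: inter.
- have : (r1 `&` r2 `&` vertices r2) (x, south r1).
    split; first by apply: inter; exact: arc_start.
    by rewrite v2; split=> //; left.
  by rewrite r12.
Qed.

(** A closed chain of arcs, of which none contains an endpoint of another in its
    interior, winds around once. First, the points [X i] are distinct: two arcs
    with a common start and different ends would be nested. Then in the lifts to
    a fundamental interval that starts at [X 0] a descent would mean that an arc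
    passes over [X 0]. *)
Lemma chain_turns_once N (X : nat -> circle R) : (0 < N)%N -> X N = X 0%N ->
  (forall i, (i < N)%N -> X i <> X i.+1) ->
  (forall i j, (i < N)%N -> (j < N)%N -> i <> j ->
    (arc (X i) (X i.+1) (X j) -> X j = X i \/ X j = X i.+1)
    /\ ~ (X i = X j /\ X i.+1 = X j.+1)) ->
  exists v : nat -> R, turn_once N v /\ forall i, (i < N)%N ->
    to_circle (v i) = X i.
Proof.
move=> N0 XN X1 H.
have no_inner i j : (i < N)%N -> (j <= N)%N ->
    arc (X i) (X i.+1) (X j) -> X j = X i \/ X j = X i.+1.
  move=> iN; rewrite leq_eqVlt => /predU1P[->|jN]; rewrite ?XN.
    by have [->|/eqP i0] := eqVneq i 0%N; [left|exact: (H i 0%N iN N0 i0).1].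
  by have [->|/eqP ij] := eqVneq i j; [left|exact: (H i j iN jN ij).1].
have same_end i j s t t' : (i < N)%N -> (j < N)%N -> to_circle s = X i ->
  X i = X j ->
    to_circle t = X i.+1 -> to_circle t' = X j.+1 -> s < t < s + 1 ->
      s < t' < s + 1 ->
    t < t' -> False.
  move=> iN jN sE ij tE t'E /andP[st ts] /andP[st' ts'] tt'.
  have tin : s <= t < s + 1 by lra.
  have : arc (X j) (X j.+1) (X i.+1).
    by rewrite -ij -sE -tE -t'E; apply/(arc_in st' ts' tin)/ltW.
  case/(no_inner j i.+1 jN iN) => [|e]; first by rewrite -ij; move/esym; exact: X1.
  by have := @to_circle_inj R s t t'; rewrite tE t'E e => /(_ _ _ _ _ erefl); lra.
have X_inj i j : (i < N)%N -> (j < N)%N -> X i = X j -> i = j.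
  move=> iN jN ij; apply: contrapT => neq.
  have [s sE _] := lift_circle 0 (X i).
  have lift k : (k < N)%N -> X k = X i ->
      exists2 t, to_circle t = X k.+1 & s < t < s + 1.
    move=> kN ki; have [t tE /andP[st ts]] := lift_circle s (X k.+1).
    exists t; rewrite // ts andbT lt_neqAle st andbT; apply/eqP => e.
    by apply: (X1 k kN); rewrite ki -sE -tE e.
  have [t tE ts] := lift i iN erefl; have [t' t'E ts'] := lift j jN (esym ij).
  case: (ltgtP t t') => [tt'|tt'|tt'].
  - exact: (same_end i j s t t').
  - by apply: (same_end j i s t' t) => //; rewrite -?ij.
  - by apply: (H i j iN jN neq).2; rewrite -tE -t'E tt'.
have [a aX _] := lift_circle 0 (X 0%N).
have /choice[V VP] : forall k, exists t, to_circle t = X k /\ a <= t < a + 1.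
  by move=> k; have [t ? ?] := lift_circle a (X k); exists t.
have V0 : V 0%N = a.
  have [+ /andP[? ?]] := VP 0%N; rewrite -aX; apply: (@to_circle_inj R a) => //;
    lra.
exists (fun k => if (k < N)%N then V k else a + 1).
split; last by move=> k kN; rewrite kN (VP k).1.
split=> [i iN|]; last by rewrite ltnn N0 V0.
rewrite iN; have [Vi /andP[ai ia]] := VP i; case: ltnP => // i1N.
have [Vi1 /andP[ai1 i1a]] := VP i.+1.
case: (ltgtP (V i) (V i.+1)) => // [lt|eq]; last first.
  by case: (X1 i iN); rewrite -Vi -Vi1 eq.
(* the arc from X i to X i.+1 passes through the start of the chain *)
have : arc (X i) (X i.+1) (X 0%N).
  rewrite -Vi -Vi1 -aX -(to_circleD1 (V i.+1)) -(to_circleD1 a).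
  apply/arc_in; lra.
case/(no_inner i 0%N iN (ltnW N0)) => [/(X_inj _ _ N0 iN) i0|/(X_inj _ _ N0 i1N)//].
by move: lt ai1; rewrite -i0 V0; lra.
Qed.

End chains.

(** * The combinatorial surface *)

Section combinatorics.
Local Open Scope nat_scope.

(** The relative position of the points of a link: column [i] contains its points
    in the rows [low i] and [high i], row [j] in the columns [leftmost j] and
    [rightmost j]. Columns and rows are numbered from 1; the index 0 is kept for
    the cut. *)
Record pattern := Pattern {
  cols : nat;
  rows : nat;
  low : nat -> nat;
  high : nat -> nat;
  leftmost : nat -> nat;
  rightmost : nat -> nat;
  low_high : forall i, 0 < i <= cols ->
    [/\ 0 < low i, low i < high i & high i <= rows];
  left_right : forall j, 0 < j <= rows ->
    [/\ 0 < leftmost j, leftmost j < rightmost j & rightmost j <= cols];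
  incidence : forall i j, 0 < i <= cols -> 0 < j <= rows ->
    (j = low i \/ j = high i) <-> (i = leftmost j \/ i = rightmost j)
}.

Context (D : pattern).

(** Two lines for each column or row and two for the wall at the cut. *)
Definition width := 2 * cols D + 2.
Definition height := 2 * rows D + 2.

(** [piece a b c d] is the rectangle [a; b] x [c; d] in the grid, the indices of
    meridians being taken modulo [width] and those of longitudes modulo
    [height]. *)
Inductive piece : nat -> nat -> nat -> nat -> Prop :=
| row_wall i of i <= cols D : piece (2 * i + 1) (2 * i + 2) 0 1
| column_wall j of j <= rows D : piece 0 1 (2 * j + 1) (2 * j + 2)
| upper_strip i of 0 < i <= cols D :
    piece (2 * i) (2 * i + 1) (2 * high D i + 1) height
| lower_strip i of 0 < i <= cols D :
    piece (2 * i) (2 * i + 1) 1 (2 * low D i)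
| right_strip j of 0 < j <= rows D :
    piece (2 * rightmost D j + 1) width (2 * j) (2 * j + 1)
| left_strip j of 0 < j <= rows D :
    piece 1 (2 * leftmost D j) (2 * j) (2 * j + 1).

Lemma piece_bounds a b c d : piece a b c d ->
  [/\ a < b, b <= width, b < a + width & [/\ c < d, d <= height & d < c + height]].
Proof.
rewrite /width /height.
by case=> [i hi|j hj|i hi|i hi|j hj|j hj];
  try have [] := low_high hi; try have [] := left_right hj; rewrite /height /width;
  do ?split; lia.
Qed.

(** The possible positions of two sides [a, b] and [a', b'] in a circle of [N]
    marks, where [N] is the same mark as 0. *)
Definition apart N a b a' b' :=
  (b < a' /\ ~ (a = 0 /\ b' = N)) \/ (b' < a /\ ~ (a' = 0 /\ b = N)).
Definition abutting a b a' b' := b <= a' \/ b' <= a.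
Definition nested a b a' b' := a < a' /\ b' < b.

Definition index_compatible N M a b c d a' b' c' d' :=
  [\/ apart N a b a' b' \/ apart M c d c' d',
      abutting a b a' b' /\ abutting c d c' d'
    | (nested a b a' b' /\ nested c' d' c d) \/
      (nested a' b' a b /\ nested c d c' d')].

Ltac sepx := right; left; left; lia.
Ltac sepy := right; left; right; lia.
Ltac abut := right; right; left; split; lia.
Ltac cross1 := right; right; right; left; do ?split; lia.
Ltac cross2 := right; right; right; right; do ?split; lia.

(** The only delicate pairs are those of a vertical and a horizontal strip. The
    strip of column [i] and that of row [j] touch if they end at a common point
    of the link. Otherwise [incidence] excludes that one ends inside the other,
    so that they cross or are disjoint. *)
Lemma piece_compatible a b c d a' b' c' d' : piece a b c d -> piece a' b' c' d' ->
  (a, b, c, d) = (a', b', c', d') \/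
  index_compatible width height a b c d a' b' c' d'.
Proof.
move=> P P'; rewrite /index_compatible.
suff : (a = a' /\ b = b' /\ c = c' /\ d = d') \/
    (apart width a b a' b' \/ apart height c d c' d') \/
    (abutting a b a' b' /\ abutting c d c' d') \/
    ((nested a b a' b' /\ nested c' d' c d) \/
      (nested a' b' a b /\ nested c d c' d')).
  case=> [[-> [-> [-> ->]]]|[?|[?|?]]]; first by left.
  - by right; constructor 1.
  - by right; constructor 2.
  - by right; constructor 3.
rewrite /apart /abutting /nested.
case: P P' => [i hi|j hj|i hi|i hi|j hj|j hj]
  [i' hi'|j' hj'|i' hi'|i' hi'|j' hj'|j' hj'];
  try have [? ? ?] := low_high hi; try have [? ? ?] := left_right hj;
  try have [? ? ?] := low_high hi'; try have [? ? ?] := left_right hj';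
  try have ? := incidence hi hj'; try have ? := incidence hi' hj;
  rewrite ?/width ?/height.
- by case: (ltngtP i i') => [?|?|->]; [sepx|sepx|left].
- by abut.
- by abut.
- by abut.
- by sepy.
- by sepy.
- by abut.
- by case: (ltngtP j j') => [?|?|->]; [sepy|sepy|left].
- by sepx.
- by sepx.
- by abut.
- by abut.
- by abut.
- by sepx.
- by case: (ltngtP i i') => [?|?|->]; [sepx|sepx|left].
- by case: (ltngtP i i') => [?|?|e]; [sepx|sepx|subst i'; sepy].
- case: (ltngtP i (rightmost D j')) => ?; first by sepx.
    by case: (ltnP (high D i) j') => ?; [cross2|sepy].
  by case: (ltngtP j' (high D i)) => ?; [sepy|exfalso; lia|abut].
- case: (ltngtP i (leftmost D j')) => ?; last 1 first.
    by case: (ltngtP j' (high D i)) => ?; [sepy|exfalso; lia|abut].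
    by case: (ltnP (high D i) j') => ?; [cross2|sepy].
  by sepx.
- by abut.
- by sepx.
- by case: (ltngtP i i') => [?|?|e]; [sepx|sepx|subst i'; sepy].
- by case: (ltngtP i i') => [?|?|->]; [sepx|sepx|left].
- case: (ltngtP i (rightmost D j')) => ?; first by sepx.
    by case: (ltnP j' (low D i)) => ?; [cross2|sepy].
  by case: (ltngtP j' (low D i)) => ?; [exfalso; lia|sepy|abut].
- case: (ltngtP i (leftmost D j')) => ?; last 1 first.
    by case: (ltngtP j' (low D i)) => ?; [exfalso; lia|sepy|abut].
    by case: (ltnP j' (low D i)) => ?; [cross2|sepy].
  by sepx.
- by sepy.
- by abut.
- case: (ltngtP i' (rightmost D j)) => ?; first by sepx.
    by case: (ltnP (high D i') j) => ?; [cross1|sepy].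
  by case: (ltngtP j (high D i')) => ?; [sepy|exfalso; lia|abut].
- case: (ltngtP i' (rightmost D j)) => ?; first by sepx.
    by case: (ltnP j (low D i')) => ?; [cross1|sepy].
  by case: (ltngtP j (low D i')) => ?; [exfalso; lia|sepy|abut].
- by case: (ltngtP j j') => [?|?|->]; [sepy|sepy|left].
- by case: (ltngtP j j') => [?|?|e]; [sepy|sepy|subst j'; sepx].
- by sepy.
- by abut.
- case: (ltngtP i' (leftmost D j)) => ?; last 1 first.
    by case: (ltngtP j (high D i')) => ?; [sepy|exfalso; lia|abut].
    by case: (ltnP (high D i') j) => ?; [cross1|sepy].
  by sepx.
- case: (ltngtP i' (leftmost D j)) => ?; last 1 first.
    by case: (ltngtP j (low D i')) => ?; [exfalso; lia|sepy|abut].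
    by case: (ltnP j (low D i')) => ?; [cross1|sepy].
  by sepx.
- by case: (ltngtP j j') => [?|?|e]; [sepy|sepy|subst j'; sepx].
- by case: (ltngtP j j') => [?|?|->]; [sepy|sepy|left].
Qed.

(** Marks are normalized to be less than [N], whence the third case. *)
Definition is_end N a b k := k = a \/ k = b \/ (k = 0 /\ b = N).

Definition corner a b c d k l := is_end width a b k /\ is_end height c d l.

Definition shared_corner a b c d k l := exists a' b' c' d',
  [/\ piece a' b' c' d', corner a' b' c' d' k l
    & ~ [/\ a = a', b = b', c = c' & d = d']].

(** Whether the link turns at the point of column [i] and row [j] along one
    diagonal or along the other decides which two of the four grid points are
    free. *)
Definition free_corner i j k l :=
  [/\ 0 < i <= cols D, j = low D i \/ j = high D i,
      2 * i <= k <= 2 * i + 1, 2 * j <= l <= 2 * j + 1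
    & ((j == low D i) == (i == leftmost D j)) = (k + l == 2 * i + 2 * j + 1)].

Ltac shared_by p := do 4 eexists; split;
  [ apply p; lia
  | rewrite /corner /is_end /width /height; split; lia
  | rewrite /width /height; case; lia ].

(** The partner of a corner: at the longitudes 0 and 1 the wall squares alternate
    with the vertical strips, at the meridians 0 and 1 with the horizontal ones,
    and at a point of the link the two strips that end there touch. *)
Lemma corner_shared_or_free a b c d k l : piece a b c d -> corner a b c d k l ->
  k < width -> l < height ->
  shared_corner a b c d k l \/ exists i j, free_corner i j k l.
Proof.
case=> [i hi|j hj|i hi|i hi|j hj|j hj] [ek el] kw lh;
  move: ek el kw lh; rewrite /is_end /width /height => ek el kw lh.
- left; case: ek => [kE|[kE|[kE iE]]]; case: el => [lE|[lE|lE]]; try by lia.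
  + have [i0|i0] := posnP i.
      by shared_by (column_wall (leqnn (rows D))).
    by shared_by (@upper_strip i).
  + have [i0|i0] := posnP i.
      by shared_by (column_wall (leq0n (rows D))).
    by shared_by (@lower_strip i).
  + by shared_by (@upper_strip i.+1).
  + by shared_by (@lower_strip i.+1).
  + by shared_by (column_wall (leqnn (rows D))).
  + by shared_by (column_wall (leq0n (rows D))).
- left; case: el => [lE|[lE|[lE iE]]]; case: ek => [kE|[kE|kE]]; try by lia.
  + have [j0|j0] := posnP j.
      by shared_by (row_wall (leqnn (cols D))).
    by shared_by (@right_strip j).
  + have [j0|j0] := posnP j.
      by shared_by (row_wall (leq0n (cols D))).
    by shared_by (@left_strip j).
  + by shared_by (@right_strip j.+1).
  + by shared_by (@left_strip j.+1).
  + by shared_by (row_wall (leqnn (cols D))).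
  + by shared_by (row_wall (leq0n (cols D))).
- have [low0 lowhigh highm] := low_high hi.
  have hj : 0 < high D i <= rows D by lia.
  have [left0 leftright rightn] := left_right hj.
  have inc := incidence hi hj.
  have {ek}ek : k = 2 * i \/ k = 2 * i + 1 by lia.
  have {el}el : l = 2 * high D i + 1 \/ l = 0 by lia.
  case: el => lE; last first.
    left; case: ek => kE; first by shared_by (@row_wall i.-1).
    by shared_by (@row_wall i).
  case: (eqVneq i (leftmost D (high D i))) => il; case: ek => kE.
  + by left; shared_by (@left_strip (high D i)).
  + by right; exists i, (high D i); split; auto; lia.
  + by right; exists i, (high D i); split; auto; lia.
  + by left; shared_by (@right_strip (high D i)).
- have [low0 lowhigh highm] := low_high hi.
  have hj : 0 < low D i <= rows D by lia.
  have [left0 leftright rightn] := left_right hj.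
  have inc := incidence hi hj.
  have {ek}ek : k = 2 * i \/ k = 2 * i + 1 by lia.
  have {el}el : l = 1 \/ l = 2 * low D i by lia.
  case: el => lE.
    left; case: ek => kE; first by shared_by (@row_wall i.-1).
    by shared_by (@row_wall i).
  case: (eqVneq i (leftmost D (low D i))) => il; case: ek => kE.
  + by left; shared_by (@left_strip (low D i)).
  + by right; exists i, (low D i); split; auto; lia.
  + by right; exists i, (low D i); split; auto; lia.
  + by left; shared_by (@right_strip (low D i)).
- have [left0 leftright rightn] := left_right hj.
  have hi : 0 < rightmost D j <= cols D by lia.
  have [low0 lowhigh highm] := low_high hi.
  have inc := incidence hi hj.
  have {ek}ek : k = 2 * rightmost D j + 1 \/ k = 0 by lia.
  have {el}el : l = 2 * j \/ l = 2 * j + 1 by lia.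
  case: ek => kE; last first.
    left; case: el => lE; first by shared_by (@column_wall j.-1).
    by shared_by (@column_wall j).
  case: (eqVneq j (low D (rightmost D j))) => jl; case: el => lE.
  + by left; shared_by (@lower_strip (rightmost D j)).
  + by right; exists (rightmost D j), j; split; auto; lia.
  + by right; exists (rightmost D j), j; split; auto; lia.
  + by left; shared_by (@upper_strip (rightmost D j)).
- have [left0 leftright rightn] := left_right hj.
  have hi : 0 < leftmost D j <= cols D by lia.
  have [low0 lowhigh highm] := low_high hi.
  have inc := incidence hi hj.
  have {ek}ek : k = 1 \/ k = 2 * leftmost D j by lia.
  have {el}el : l = 2 * j \/ l = 2 * j + 1 by lia.
  case: ek => kE.
    left; case: el => lE; first by shared_by (@column_wall j.-1).
    by shared_by (@column_wall j).
  case: (eqVneq j (low D (leftmost D j))) => jl; case: el => lE.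
  + by left; shared_by (@lower_strip (leftmost D j)).
  + by right; exists (leftmost D j), j; split; auto; lia.
  + by right; exists (leftmost D j), j; split; auto; lia.
  + by left; shared_by (@upper_strip (leftmost D j)).
Qed.

Lemma free_corner_bounds i j k l : free_corner i j k l -> k < width /\ l < height.
Proof.
case=> hi jE kE lE _; have [low0 lowhigh highm] := low_high hi.
by rewrite /width /height; split; [clear jE|clear kE]; lia.
Qed.

Lemma free_corner_pieces i j k l a b c d :
  free_corner i j k l -> piece a b c d -> corner a b c d k l ->
  [\/ (a, b, c, d) = (2 * i, 2 * i + 1, 2 * high D i + 1, height)
        /\ (j = high D i /\ l = 2 * j + 1),
      (a, b, c, d) = (2 * i, 2 * i + 1, 1, 2 * low D i)
        /\ (j = low D i /\ l = 2 * j),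
      (a, b, c, d) = (2 * rightmost D j + 1, width, 2 * j, 2 * j + 1)
        /\ (i = rightmost D j /\ k = 2 * i + 1)
    | (a, b, c, d) = (1, 2 * leftmost D j, 2 * j, 2 * j + 1)
        /\ (i = leftmost D j /\ k = 2 * i)].
Proof.
case=> hi jE kE lE _.
have [low0 lowhigh highm] := low_high hi.
have hj : 0 < j <= rows D by lia.
have [left0 leftright rightn] := left_right hj.
case=> [i' hi'|j' hj'|i' hi'|i' hi'|j' hj'|j' hj'];
  rewrite /corner /is_end /width /height => -[ek el].
- by lia.
- by lia.
- by have e : i' = i by [lia]; subst i'; constructor 1; do ?split; lia.
- by have e : i' = i by [lia]; subst i'; constructor 2; do ?split; lia.
- by have e : j' = j by [lia]; subst j'; constructor 3; do ?split; lia.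
- by have e : j' = j by [lia]; subst j'; constructor 4; do ?split; lia.
Qed.

Lemma free_corner_unique i j k l a b c d a' b' c' d' : free_corner i j k l ->
  piece a b c d -> corner a b c d k l -> piece a' b' c' d' ->
    corner a' b' c' d' k l ->
  (a, b, c, d) = (a', b', c', d').
Proof.
move=> fc p cp p' cp'; have := free_corner_pieces fc p' cp'.
have := free_corner_pieces fc p cp; case: fc => hi jE kE lE parity.
have [low0 lowhigh highm] := low_high hi.
have hj : 0 < j <= rows D by lia.
have [left0 leftright rightn] := left_right hj.
by case=> -[-> [? ?]]; case=> -[-> [? ?]]; rewrite //; exfalso; lia.
Qed.

Lemma free_corner_exists i j k l : free_corner i j k l ->
  exists a b c d, piece a b c d /\ corner a b c d k l.
Proof.
case=> hi jE kE lE parity.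
have [low0 lowhigh highm] := low_high hi.
have hj : 0 < j <= rows D by clear parity; lia.
have inc := (incidence hi hj).1 jE.
have [[e le]|[[e le]|[[e ke]|[e ke]]]] :
    (j = high D i /\ l = 2 * j + 1) \/ (j = low D i /\ l = 2 * j) \/
    (i = rightmost D j /\ k = 2 * i + 1) \/ (i = leftmost D j /\ k = 2 * i).
- move: parity; have [jl|jl] := eqVneq j (low D i);
    have [il|il] := eqVneq i (leftmost D j) => /= parity.
  + by move: jl il kE lE parity; clear; lia.
  + by have {inc}il : i = rightmost D j by [case: inc il => // ->; rewrite eqxx];
      move: jl il kE lE parity; clear; lia.
  + by have {jE}jl : j = high D i by [case: jE jl => // ->; rewrite eqxx];
      move: jl il kE lE parity; clear; lia.
  + have {inc}il : i = rightmost D j by [case: inc il => // ->; rewrite eqxx].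
    by have {jE}jl : j = high D i by [case: jE jl => // ->; rewrite eqxx];
      move: jl il kE lE parity; clear; lia.
- do 4 eexists; split; [exact: (upper_strip hi)|].
  by move: kE le e; rewrite /corner /is_end; clear; split; lia.
- do 4 eexists; split; [exact: (lower_strip hi)|].
  by move: kE le e; rewrite /corner /is_end; clear; split; lia.
- do 4 eexists; split; [exact: (right_strip hj)|].
  by move: lE ke e; rewrite /corner /is_end; clear; split; lia.
- do 4 eexists; split; [exact: (left_strip hj)|].
  by move: lE ke e; rewrite /corner /is_end; clear; split; lia.
Qed.

(** A free corner is determined by its meridian, up to the choice between the two
    points of the link in its column. *)
Lemma free_corner_row i j i' j' k l l' : free_corner i j k l ->
  free_corner i' j' k l' -> (j == low D i) = (j' == low D i') -> l = l'.
Proof.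
move=> [hi jE kE lE par] [hi' jE' kE' lE' par'] e.
have ii' : i' = i by move: kE kE'; clear; lia.
subst i'; have [_ lowhigh _] := low_high hi.
have jj' : j' = j by move: jE jE' e lowhigh; clear; case=> ->; case=> ->; lia.
by subst j'; move: par kE lE lE'; rewrite par'; clear; lia.
Qed.

(** Likewise for longitudes. *)
Lemma free_corner_column i j i' j' k k' l : free_corner i j k l ->
  free_corner i' j' k' l -> (i == leftmost D j) = (i' == leftmost D j') -> k = k'.
Proof.
move=> [hi jE kE lE par] [hi' jE' kE' lE' par'] e.
have [low0 lowhigh highm] := low_high hi.
have jj' : j' = j by move: lE lE'; clear; lia.
subst j'; have hj : 0 < j <= rows D by move: jE lowhigh low0 highm; clear; lia.
have inc := (incidence hi hj).1 jE; have inc' := (incidence hi' hj).1 jE'.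
have [_ leftright _] := left_right hj.
have ii' : i' = i by move: inc inc' e leftright; clear; case=> ->; case=> ->; lia.
by subst i'; move: par lE kE kE'; rewrite par'; clear; lia.
Qed.

End combinatorics.

(** * Realization in the torus *)

Section subdivision.
Context {R : realType} (N : nat) (x : nat -> R) (x_turn : turn_once N x).
Implicit Types (t : R) (z : circle R) (a b i j k : nat).

Let mark i := to_circle (x i).

Lemma subdivision_lt i j : (i < j)%N -> (j <= N)%N -> x i < x j.
Proof.
move=> ij jN; apply: (lt_le_trans (x_turn.1 i (leq_trans ij jN))).
exact: turn_once_le x_turn ij jN.
Qed.

Lemma subdivision_range i : (i <= N)%N -> x 0%N <= x i <= x 0%N + 1.
Proof.
move=> iN; rewrite -x_turn.2 (turn_once_le x_turn (leq0n i) iN).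
exact: turn_once_le x_turn iN (leqnn N).
Qed.

Lemma subdivision_inj i j : (i <= N)%N -> (j <= N)%N -> x i = x j -> i = j.
Proof.
move=> iN jN e; case: (ltngtP i j) => // ij.
  by have := subdivision_lt ij jN; rewrite e ltxx.
by have := subdivision_lt ij iN; rewrite e ltxx.
Qed.

Lemma to_circle_turn s t : x 0%N <= s <= x 0%N + 1 -> x 0%N <= t <= x 0%N + 1 ->
  to_circle s = to_circle t ->
  [\/ s = t, s = x 0%N /\ t = x N | s = x N /\ t = x 0%N].
Proof.
rewrite x_turn.2 => /andP[s0 s1] /andP[t0 t1].
move: s1 t1; rewrite le_eqVlt => /predU1P[->|s1];
  rewrite le_eqVlt => /predU1P[->|t1].
- by constructor 1.
- rewrite to_circleD1 => /(@to_circle_inj R (x 0%N)) e; constructor 3; split=> //.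
  by rewrite -e//; lra.
- rewrite to_circleD1 => /(@to_circle_inj R (x 0%N)) e; constructor 2; split=> //.
  by rewrite e//; lra.
- by move=> /(@to_circle_inj R (x 0%N)) e; constructor 1; exact: e.
Qed.

Lemma mark_inj i j : (i < N)%N -> (j < N)%N -> mark i = mark j -> i = j.
Proof.
move=> iN jN /(to_circle_turn (subdivision_range (ltnW iN)) (subdivision_range
  (ltnW jN))).
have neqN k : (k < N)%N -> x k <> x N.
  by move=> kN e; have := subdivision_lt kN (leqnn N); rewrite e ltxx.
case=> [|[_ /(neqN _ jN)]|[/(neqN _ iN)]] //.
by apply: subdivision_inj; exact: ltnW.
Qed.

Lemma mark_N : mark N = mark 0%N.
Proof. by rewrite /mark x_turn.2 to_circleD1. Qed.

Lemma mark_endsP a b z : (a < b)%N -> (b <= N)%N ->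
  [set mark a; mark b] z <-> exists k, [/\ (k < N)%N, is_end N a b k & z = mark k].
Proof.
move=> ab bN; split=> [[->|->]|[k [kN + ->]]].
- by exists a; split; [exact: leq_trans ab bN|left|].
- move: bN; rewrite leq_eqVlt => /predU1P[bE|bN].
    by exists 0%N; rewrite bE mark_N; split; [lia|right; right|].
  by exists b; split; [|right; left|].
- by case=> [->|[->|[-> ->]]]; [left|right|right; rewrite mark_N].
Qed.

Lemma mark_neq a b : (a < b)%N -> (b <= N)%N -> (b < a + N)%N -> mark a <> mark b.
Proof.
move=> ab bN ba; have aN := leq_trans ab bN;
  case: (ltngtP b N) (bN) => // [bN' _|bE _].
  by move=> /(mark_inj aN bN'); lia.
by rewrite bE mark_N => /(mark_inj aN (leq_ltn_trans (leq0n a) aN)); lia.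
Qed.

(** All arcs between marks lift to the fundamental interval from [x 0] to [x N],
    in which only the two ends are identified. *)
Lemma arc_marksP a b z : (a < b)%N -> (b <= N)%N -> (b < a + N)%N ->
  arc (mark a) (mark b) z <->
  exists t, [/\ to_circle t = z, x a <= t <= x b & x 0%N <= t <= x 0%N + 1].
Proof.
move=> ab bN ba; have x_ab := subdivision_lt ab bN.
have /andP[a0 a1] := subdivision_range (leq_trans (ltnW ab) bN).
have /andP[b0 b1] := subdivision_range bN.
have short : x b < x a + 1.
  case: (ltngtP b N) (bN) => // [bN' _|bE _].
    by have := subdivision_lt bN' (leqnn N); rewrite x_turn.2; lra.
  have a_gt0 : (0 < a)%N by lia.
  have := subdivision_lt a_gt0 (leq_trans (ltnW ab) bN).
  by rewrite bE x_turn.2; lra.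
rewrite arcE//; split=> [[t /= /andP[at_ tb] <-]|[t [<- tab _]]]; last by exists t.
by exists t; split=> //; lra.
Qed.

Lemma arc_apart a b a' b' z :
  (a < b)%N -> (b <= N)%N -> (b < a + N)%N -> (a' < b')%N -> (b' <= N)%N ->
    (b' < a' + N)%N ->
  apart N a b a' b' ->
  arc (mark a) (mark b) z -> arc (mark a') (mark b') z -> False.
Proof.
move=> ab bN ba ab' bN' ba' sep.
move=> /(arc_marksP _ ab bN ba)[t [tz tab t01]].
move=> /(arc_marksP _ ab' bN' ba')[s [+ sab s01]].
rewrite -tz => /esym/(to_circle_turn t01 s01) st.
have at0 c : (c <= N)%N -> x c <= x 0%N -> c = 0%N.
  by move=> cN; rewrite leNgt; case: (posnP c) => // c0; rewrite subdivision_lt.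
have atN c : (c <= N)%N -> x N <= x c -> c = N.
  move=> cN; rewrite leNgt; case: (ltngtP c N) cN => // cN _.
  by rewrite subdivision_lt.
have aN := leq_trans (ltnW ab) bN; have aN' := leq_trans (ltnW ab') bN'.
case: st => [e|[tE sE]|[tE sE]].
- subst s; case: sep => -[lt _].
    by have := subdivision_lt lt aN'; lra.
  by have := subdivision_lt lt aN; lra.
- have a0 : a = 0%N by apply: at0 => //; rewrite -tE; case/andP: tab.
  have b'N : b' = N by apply: atN => //; rewrite -sE; case/andP: sab.
  by move: sep ab bN'; rewrite /apart a0 b'N; clear; lia.
- have a'0 : a' = 0%N by apply: at0 => //; rewrite -sE; case/andP: sab.
  have bN_ : b = N by apply: atN => //; rewrite -tE; case/andP: tab.
  by move: sep ab' bN; rewrite /apart a'0 bN_; clear; lia.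
Qed.

Lemma arc_abutting a b a' b' z :
  (a < b)%N -> (b <= N)%N -> (b < a + N)%N -> (a' < b')%N -> (b' <= N)%N ->
    (b' < a' + N)%N ->
  abutting a b a' b' ->
  arc (mark a) (mark b) z -> arc (mark a') (mark b') z -> [set mark a; mark b] z.
Proof.
move=> ab bN ba ab' bN' ba' abut_.
move=> /(arc_marksP _ ab bN ba)[t [tz tab t01]].
move=> /(arc_marksP _ ab' bN' ba')[s [+ sab s01]].
have aN := leq_trans (ltnW ab) bN; have aN' := leq_trans (ltnW ab') bN'.
have /andP[a0 _] := subdivision_range aN; have /andP[_ b1] := subdivision_range bN.
rewrite -x_turn.2 in b1.
rewrite -tz => /esym/(to_circle_turn t01 s01)[e|[tE sE]|[tE sE]].
- subst s; case: abut_ => le.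
    by right; have := turn_once_le x_turn le aN' => ?; congr to_circle; lra.
  by left; have := turn_once_le x_turn le aN => ?; congr to_circle; lra.
- by left; congr to_circle; lra.
- by right; congr to_circle; lra.
Qed.

Lemma arc_nested a b a' b' :
  (a < b)%N -> (b <= N)%N -> (b < a + N)%N -> (a' < b')%N -> (b' <= N)%N ->
    (b' < a' + N)%N ->
  nested a b a' b' ->
  arc (mark a) (mark b) `&` arc (mark a') (mark b') = arc (mark a') (mark b')
  /\ forall z, arc (mark a') (mark b') z -> [set mark a; mark b] z -> False.
Proof.
move=> ab bN ba ab' bN' ba' [aa' bb'].
have aN := leq_trans (ltnW ab) bN; have aN' := leq_trans (ltnW ab') bN'.
have xaa' := subdivision_lt aa' aN'; have xbb' := subdivision_lt bb' bN.
split.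
  apply/setIidPr => z /(arc_marksP _ ab' bN' ba')[s [sz sab s01]].
  by apply/(arc_marksP _ ab bN ba); exists s; split=> //; lra.
move=> z /(arc_marksP _ ab' bN' ba')[s [<- sab s01]].
have ra := subdivision_range aN; have rb := subdivision_range bN.
by case=> /to_circle_turn; rewrite ?x_turn.2 => -[]//; lra.
Qed.

End subdivision.

(** The form in which the bound on free vertices is obtained: each point of [A]
    carries one of two labels, which determines the point. *)
Lemma card_le2 (T : choiceType) (A : set T) (B : bool -> set T) :
  (forall p, A p -> exists e, B e p) ->
  (forall e p q, A p -> A q -> B e p -> B e q -> p = q) -> A #<= `I_2.
Proof.
move=> AB B1; have [->|/set0P[d Ad]] := eqVneq A set0; first exact: card_ge0.
pose f (n : nat) := xget d (A `&` B (n == 0%N)).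
apply: card_le_trans (card_image_le f `I_2); apply: subset_card_le => p Ap.
have [e Be] := AB p Ap; exists (~~ e : nat); first by case: (e).
have -> : f (~~ e : nat) = xget d (A `&` B e) by rewrite /f; case: (e).
case: xgetP => [q _ [Aq Bq]|/(_ p)[]//]; exact: B1 Be.
Qed.

Section surface.
Context {R : realType} (D : pattern) (x y : nat -> R).
Context (x_turn : turn_once (width D) x) (y_turn : turn_once (height D) y).

Definition tile a b c d : set (torus R) :=
  arc (to_circle (x a)) (to_circle (x b)) `*` arc (to_circle (y c)) (to_circle (y
    d)).

Definition surface : set (set (torus R)) :=
  [set r | exists a b c d, piece D a b c d /\ r = tile a b c d].

Lemma tile_rectangle a b c d : piece D a b c d ->
  rectangle_at (to_circle (x a)) (to_circle (x b)) (to_circle (y c)) (to_circle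
    (y d))
    (tile a b c d).
Proof.
move=> /piece_bounds[ab bW ba [cd dH dc]].
by split=> //; [exact: (mark_neq x_turn)|exact: (mark_neq y_turn)].
Qed.

Lemma tile_vertices a b c d p : piece D a b c d -> vertices (tile a b c d) p <->
  exists k l, [/\ (k < width D)%N, (l < height D)%N, corner D a b c d k l
    & p = (to_circle (x k), to_circle (y l))].
Proof.
move=> P; have [ab bW ba [cd dH dc]] := piece_bounds P.
rewrite (verticesE (tile_rectangle P)).
have endx := mark_endsP x_turn _ ab bW; have endy := mark_endsP y_turn _ cd dH.
case: p => p1 p2; split=> [[/= /endx[k [kW ke ->]] /endy[l [lH le ->]]]|].
  by exists k, l.
move=> [k [l [kW lH [ke le] [-> ->]]]]; split; [apply/endx|apply/endy].
  by exists k.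
by exists l.
Qed.

(** The left end of a side is never the mark [N] and the right end never 0, so
    that the identification of these two marks causes no ambiguity. *)
Lemma tile_inj a b c d a' b' c' d' : piece D a b c d -> piece D a' b' c' d' ->
  tile a b c d = tile a' b' c' d' -> (a, b, c, d) = (a', b', c', d').
Proof.
move=> P P' e; have := tile_rectangle P'; rewrite -e => t'.
have [ea eb ec ed] := rectangle_at_inj (tile_rectangle P) t'.
have [ab bW ba [cd dH dc]] := piece_bounds P.
have [ab' bW' ba' [cd' dH' dc']] := piece_bounds P'.
have start N (u : nat -> R) i j i' j' : turn_once N u -> (i < j)%N -> (j <= N)%N ->
    (i' < j')%N -> (j' <= N)%N ->
    to_circle (u i) = to_circle (u i') -> i = i'.
  move=> tu ij jN ij' jN'; apply: (mark_inj tu); lia.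
have stop N (u : nat -> R) i j i' j' : turn_once N u -> (i < j)%N -> (j <= N)%N ->
    (i' < j')%N -> (j' <= N)%N ->
    to_circle (u j) = to_circle (u j') -> j = j'.
  move=> tu ij jN ij' jN'.
  have [->|lt] : j = N \/ (j < N)%N by lia.
    have [-> //|lt'] : j' = N \/ (j' < N)%N by lia.
    by rewrite (mark_N tu) => /esym/(mark_inj tu lt'); lia.
  have [->|lt'] : j' = N \/ (j' < N)%N by lia.
    by rewrite (mark_N tu) => /(mark_inj tu lt); lia.
  exact: (mark_inj tu).
by congr (_, _, _, _); [exact: start x_turn ab bW ab' bW' ea
  |exact: stop x_turn ab bW ab' bW' eb|exact: start y_turn cd dH cd' dH' ec
  |exact: stop y_turn cd dH cd' dH' ed].
Qed.

Lemma tile_compatible a b c d a' b' c' d' : piece D a b c d ->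
  piece D a' b' c' d' ->
  tile a b c d <> tile a' b' c' d' -> compatible (tile a b c d) (tile a' b' c' d').
Proof.
move=> P P' neq; have [[ea eb ec ed]|cpt] := piece_compatible P P'.
  by case: neq; rewrite ea eb ec ed.
have [ab bW ba [cd dH dc]] := piece_bounds P.
have [ab' bW' ba' [cd' dH' dc']] := piece_bounds P'.
have V := verticesE (tile_rectangle P); have V' := verticesE (tile_rectangle P').
have nx := mark_neq x_turn ab bW ba; have nx' := mark_neq x_turn ab' bW' ba'.
have ny := mark_neq y_turn cd dH dc; have ny' := mark_neq y_turn cd' dH' dc'.
case: cpt => [apart|[abx aby]|cross].
- constructor 1; rewrite -subset0 => -[p1 p2] [[/= ax ay] [/= ax' ay']].
  case: apart => apart.
    exact: (arc_apart x_turn ab bW ba ab' bW' ba' apart ax ax').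
  exact: (arc_apart y_turn cd dH dc cd' dH' dc' apart ay ay').
- constructor 2; rewrite V => -[p1 p2] [[/= ax ay] [/= ax' ay']]; split=> /=.
    exact: (arc_abutting x_turn ab bW ba ab' bW' ba' abx ax ax').
  exact: (arc_abutting y_turn cd dH dc cd' dH' dc' aby ay ay').
- constructor 3; rewrite V V' -setXI.
  case: cross => -[nestx nesty].
    have [-> offx] := arc_nested x_turn ab bW ba ab' bW' ba' nestx.
    have [cdI offy] := arc_nested y_turn cd' dH' dc' cd dH dc nesty.
    rewrite setIC in cdI; rewrite cdI; split; first by exists (to_circle (x a')),
      (to_circle (x b')), (to_circle (y c)), (to_circle (y d)).
      by rewrite -subset0 => -[p1 p2] [[/= ax _] [/= ex _]]; exact: offx ax ex.
    by rewrite -subset0 => -[p1 p2] [[/= _ ay] [/= _ ey]]; exact: offy ay ey.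
  have [abI offx] := arc_nested x_turn ab' bW' ba' ab bW ba nestx.
  have [-> offy] := arc_nested y_turn cd dH dc cd' dH' dc' nesty.
  rewrite setIC in abI; rewrite abI; split; first by exists (to_circle (x a)),
    (to_circle (x b)), (to_circle (y c')), (to_circle (y d')).
    by rewrite -subset0 => -[p1 p2] [[/= _ ay] [/= _ ey]]; exact: offy ay ey.
  by rewrite -subset0 => -[p1 p2] [[/= ax _] [/= ex _]]; exact: offx ax ex.
Qed.

Lemma surface_boundaryP p : boundary surface p <->
  exists i j k l, free_corner D i j k l /\ p = (to_circle (x k), to_circle (y l)).
Proof.
split.
  move=> [_ [[[a [b [c [d [P ->]]]]] /(tile_vertices _ P)[k [l
    [kW lH kl ->]]]] only]].
  have [[a' [b' [c' [d' [P' kl' neq]]]]]|[i [j fc]]] :=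
    corner_shared_or_free P kl kW lH; last by exists i, j, k, l.
  have : tile a b c d = tile a' b' c' d'.
    apply: only; split; first by exists a', b', c', d'.
    by apply/(tile_vertices _ P'); exists k, l.
  by move=> /(tile_inj P P')[ea eb ec ed]; case: neq; split.
move=> [i [j [k [l [fc ->]]]]].
have [a [b [c [d [P kl]]]]] := free_corner_exists fc.
have [kW lH] := free_corner_bounds fc.
exists (tile a b c d); split.
  split; first by exists a, b, c, d.
  by apply/(tile_vertices _ P); exists k, l.
move=> _ [[a' [b' [c' [d' [P' ->]]]]] /(tile_vertices _ P')[k' [l' [kW' lH' kl'
  [ek el]]]]].
have kk' := mark_inj x_turn kW kW' ek; have ll' := mark_inj y_turn lH lH' el.
rewrite -kk' -ll' in kl'.
by have [-> -> -> ->] := free_corner_unique fc P kl P' kl'.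
Qed.

Lemma surface_diagram : is_surface_diagram surface.
Proof.
split.
- pose I := ('I_(width D).+1 * 'I_(width D).+1 *
    ('I_(height D).+1 * 'I_(height D).+1))%type.
  have fin : finite_set ((fun q : I => tile (q.1.1 : nat) (q.1.2 : nat)
      (q.2.1 : nat) (q.2.2 : nat)) @` setT).
    by apply: finite_image; exact: finite_finset.
  apply: sub_finite_set fin.
  move=> _ [a [b [c [d [P ->]]]]]; have [ab bW _ [cd dH _]] := piece_bounds P.
  exists ((inord a, inord b), (inord c, inord d)) => //=.
  by rewrite !inordK//; lia.
- by move=> _ [a [b [c [d [P ->]]]]]; do 4 eexists; exact: tile_rectangle.
- move=> _ _ [a [b [c [d [P ->]]]]] [a' [b' [c' [d' [P' ->]]]]].
  exact: tile_compatible.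
- move=> t; apply: (card_le2 (B := fun e p => exists i j k l,
    [/\ free_corner D i j k l, p = (to_circle (x k), to_circle (y l))
      & (j == low D i) = e])).
    move=> p [_ /surface_boundaryP[i [j [k [l [fc ->]]]]]].
    by exists (j == low D i), i, j, k, l.
  move=> e p q [[pt _] _] [[qt _] _] [i [j [k [l [fc pE je]]]]] [i' [j' [k' [l'
    [fc' qE je']]]]].
  move: pt qt; rewrite pE qE /= => <- kk'.
  have [kW lH] := free_corner_bounds fc; have [kW' lH'] := free_corner_bounds fc'.
  have {}kk' := mark_inj x_turn kW' kW kk'.
  by rewrite kk' in fc' *; rewrite (free_corner_row fc fc' _)// je je'.
- move=> t; apply: (card_le2 (B := fun e p => exists i j k l,
    [/\ free_corner D i j k l, p = (to_circle (x k), to_circle (y l))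
      & (i == leftmost D j) = e])).
    move=> p [_ /surface_boundaryP[i [j [k [l [fc ->]]]]]].
    by exists (i == leftmost D j), i, j, k, l.
  move=> e p q [[_ pt] _] [[_ qt] _] [i [j [k [l [fc pE je]]]]] [i' [j' [k' [l'
    [fc' qE je']]]]].
  move: pt qt; rewrite pE qE /= => <- ll'.
  have [kW lH] := free_corner_bounds fc; have [kW' lH'] := free_corner_bounds fc'.
  have {}ll' := mark_inj y_turn lH' lH ll'.
  by rewrite ll' in fc' *; rewrite (free_corner_column fc fc' _)// je je'.
Qed.

End surface.

(** * Rigidity *)

Section rigidity.
Context {R : realType} (D : pattern) (x y : nat -> R).
Context (x_turn : turn_once (width D) x) (y_turn : turn_once (height D) y).
Context (P' : set (set (torus R))) (P'_surface : is_surface_diagram P').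
Context (phi : set (torus R) ->
  set (torus R)) (phi_bij : set_bij (surface D x y) P' phi).
Context (phi_ne : forall r1 r2, surface D x y r1 -> surface D x y r2 ->
  (nearrow r1 r2 <-> nearrow (phi r1) (phi r2))).
Context (phi_se : forall r1 r2, surface D x y r1 -> surface D x y r2 ->
  (searrow r1 r2 <-> searrow (phi r1) (phi r2))).

(** The rectangle of [P'] that corresponds to a piece. *)
Definition copy a b c d := phi (tile x y a b c d).

Lemma piece_surface a b c d : piece D a b c d -> surface D x y (tile x y a b c d).
Proof. by exists a, b, c, d. Qed.

Lemma copy_in a b c d : piece D a b c d -> P' (copy a b c d).
Proof. by case: phi_bij => + _ _ => /[swap]/piece_surface p; apply. Qed.

Lemma copy_rectangle a b c d : piece D a b c d -> is_rectangle (copy a b c d).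
Proof. by move=> /copy_in; case: P'_surface => _ + _ _ _; apply. Qed.

Lemma copy_compatible a b c d a' b' c' d' : piece D a b c d ->
  piece D a' b' c' d' ->
  (a, b, c, d) <> (a', b', c', d') -> compatible (copy a b c d) (copy a' b' c' d').
Proof.
move=> P Q neq; case: P'_surface => _ _ + _ _; apply; try exact: copy_in.
case: phi_bij => _ inj _ /inj e; apply: neq.
by apply: (tile_inj x_turn y_turn P Q); apply: e; apply/mem_set;
  exact: piece_surface.
Qed.

Lemma copy_nearrow a b c d a' b' c' d' : piece D a b c d -> piece D a' b' c' d' ->
  to_circle (x b) = to_circle (x a') -> to_circle (y d) = to_circle (y c') ->
  east (copy a b c d) = west (copy a' b' c' d') /\
  north (copy a b c d) = south (copy a' b' c' d').
Proof.
move=> P Q ex ey; apply/(nearrowE (copy_rectangle P) (copy_rectangle Q)).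
apply/(phi_ne (piece_surface P) (piece_surface Q)).
by do 6 eexists; split; [exact: tile_rectangle P|rewrite ex ey;
  exact: tile_rectangle Q].
Qed.

Lemma copy_searrow a b c d a' b' c' d' : piece D a b c d -> piece D a' b' c' d' ->
  to_circle (x b) = to_circle (x a') -> to_circle (y c) = to_circle (y d') ->
  east (copy a b c d) = west (copy a' b' c' d') /\
  south (copy a b c d) = north (copy a' b' c' d').
Proof.
move=> P Q ex ey; apply/(searrowE (copy_rectangle P) (copy_rectangle Q)).
apply/(phi_se (piece_surface P) (piece_surface Q)).
by do 6 eexists; split; [exact: tile_rectangle P|rewrite ex ey;
  exact: tile_rectangle Q].
Qed.

Let xN : to_circle (x (width D)) = to_circle (x 0%N) := mark_N x_turn.
Let yN : to_circle (y (height D)) = to_circle (y 0%N) := mark_N y_turn.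

(** The closed chain along the longitude 0: above it the wall squares, below it
    the upper strips and, between the meridians 0 and 1, the topmost square of
    the other wall. *)
Definition row_bottom k := if odd k then 0%N
  else if k == 0%N then (2 * rows D + 1)%N else (2 * high D k./2 + 1)%N.
Definition row_top k := if odd k then 1%N else height D.
Definition row_chain k := copy k k.+1 (row_bottom k) (row_top k).

(** The closed chain along the meridian 0: to the right of it the wall squares, to
    the left the right strips and, between the longitudes 0 and 1, the last
    square of the other wall. *)
Definition column_left k := if odd k then 0%N
  else if k == 0%N then (2 * cols D + 1)%N else (2 * rightmost D k./2 + 1)%N.
Definition column_right k := if odd k then 1%N else width D.
Definition column_chain k := copy (column_left k) (column_right k) k k.+1.

Lemma row_chain_piece k : (k < width D)%N ->
  piece D k k.+1 (row_bottom k) (row_top k).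
Proof.
rewrite /row_bottom /row_top /width => kW; have kE := odd_double_half k;
  case: ifP => ko; rewrite ko in kE.
  have -> : (k = 2 * k./2 + 1)%N by lia.
  have -> : ((2 * k./2 + 1)%N.+1 = 2 * k./2 + 2)%N by lia.
  by apply: row_wall; lia.
case: eqVneq => [->|k0].
  by have := column_wall (leqnn (rows D)); rewrite /height.
have kE' : (k = 2 * k./2)%N by lia.
by rewrite -[k.+1]addn1 {1 2}kE'; apply: upper_strip; lia.
Qed.

Lemma column_chain_piece k : (k < height D)%N ->
  piece D (column_left k) (column_right k) k k.+1.
Proof.
rewrite /column_left /column_right /height => kH; have kE := odd_double_half k;
  case: ifP => ko; rewrite ko in kE.
  have -> : (k = 2 * k./2 + 1)%N by lia.
  have -> : ((2 * k./2 + 1)%N.+1 = 2 * k./2 + 2)%N by lia.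
  by apply: column_wall; lia.
case: eqVneq => [->|k0].
  by have := row_wall (leqnn (cols D)); rewrite /width.
have kE' : (k = 2 * k./2)%N by lia.
by rewrite -[k.+1]addn1 {2 3}kE'; apply: right_strip; lia.
Qed.

(** The marks of [P'] that the two chains define; all sides of [P'] will be
    among them. *)
Let X k := west (row_chain (k %% width D)).
Let Y k := south (column_chain (k %% height D)).

Let XN : X (width D) = X 0%N.
Proof. by rewrite /X modnn mod0n. Qed.
Let YN : Y (height D) = Y 0%N.
Proof. by rewrite /Y modnn mod0n. Qed.

Let WO : (0 < width D)%N. Proof. by rewrite /width; lia. Qed.
Let HO : (0 < height D)%N. Proof. by rewrite /height; lia. Qed.

Lemma row_chain_west k : (k < width D)%N -> west (row_chain k) = X k.
Proof. by move=> kW; rewrite /X modn_small. Qed.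

Lemma column_chain_south k : (k < height D)%N -> south (column_chain k) = Y k.
Proof. by move=> kW; rewrite /Y modn_small. Qed.

(** Consecutive members of the chain touch at corners of their sides on the
    longitude 0, whose images therefore all lie on one longitude. It is called
    [Y 0] because the wall square [2n + 1; 2n + 2] x [0; 1] belongs to both
    chains. *)
Lemma row_chain_step k : (k < width D)%N -> east (row_chain k) = X k.+1 /\
  (if odd k then south (row_chain k) else north (row_chain k)) = Y 0%N.
Proof.
have step l : (l < width D)%N ->
    east (row_chain l) = west (row_chain (l.+1 %% width D)) /\
    (if odd l then south (row_chain l) else north (row_chain l)) =
    (if odd (l.+1 %% width D) then south (row_chain (l.+1 %% width D))
     else north (row_chain (l.+1 %% width D))).
  move=> lW; have nW := ltn_pmod l.+1 WO.
  have nE : to_circle (x l.+1) = to_circle (x (l.+1 %% width D)%N).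
    have [lt|->] : (l.+1 < width D)%N \/ l.+1 = width D by lia.
      by rewrite modn_small.
    by rewrite modnn.
  have no : odd (l.+1 %% width D) = ~~ odd l.
    have [lt|eq] : (l.+1 < width D)%N \/ l.+1 = width D by lia.
      by rewrite modn_small.
    by rewrite eq modnn /=; move: (congr1 odd eq);
      rewrite /width /= oddD oddM /=; case: odd.
  have Pl := row_chain_piece lW; have Pn := row_chain_piece nW.
  rewrite no; case: (boolP (odd l)) => lo.
    by apply: copy_searrow => //; rewrite /row_bottom /row_top no lo.
  by apply: copy_nearrow => //; rewrite /row_bottom /row_top no (negbTE lo).
move=> kW; split; first by rewrite (step k kW).1.
have last_row : (width D).-1 = (2 * cols D + 1)%N by rewrite /width; lia.
suff all l : (l < width D)%N ->
  (if odd k then south (row_chain k) else north (row_chain k)) =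
   (if odd ((k + l) %% width D) then south (row_chain ((k + l) %% width D))
     else north (row_chain ((k + l) %% width D))).
  have := all ((width D).-1 - k)%N; rewrite subnKC; last by lia.
  rewrite modn_small; last by lia.
  move=> ->; last by lia.
  rewrite last_row oddD oddM /= /row_chain /row_bottom /row_top oddD oddM /= /Y
    mod0n /column_chain /column_left /column_right /=.
  by rewrite /width addn1 addn2.
elim: l => [|l IH] lW; first by rewrite addn0 modn_small.
rewrite IH; last by lia.
have nW := ltn_pmod (k + l) WO.
by rewrite (step _ nW).2 -addn1 modnDml addn1 addnS.
Qed.

(** Along the meridian 0 the even members are the ones on the western side; the
    chain is read from south to north, which reverses every second arrow. *)
Lemma column_chain_step k : (k < height D)%N -> north (column_chain k) = Y k.+1 /\
  (if odd k then west (column_chain k) else east (column_chain k)) = X 0%N.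
Proof.
have step l : (l < height D)%N ->
    north (column_chain l) = south (column_chain (l.+1 %% height D)) /\
    (if odd l then west (column_chain l) else east (column_chain l)) =
    (if odd (l.+1 %% height D) then west (column_chain (l.+1 %% height D))
     else east (column_chain (l.+1 %% height D))).
  move=> lW; have nW := ltn_pmod l.+1 HO.
  have nE : to_circle (y l.+1) = to_circle (y (l.+1 %% height D)%N).
    have [lt|->] : (l.+1 < height D)%N \/ l.+1 = height D by lia.
      by rewrite modn_small.
    by rewrite modnn.
  have no : odd (l.+1 %% height D) = ~~ odd l.
    have [lt|eq] : (l.+1 < height D)%N \/ l.+1 = height D by lia.
      by rewrite modn_small.
    by rewrite eq modnn /=; move: (congr1 odd eq);
      rewrite /height /= oddD oddM /=; case: odd.
  have Pl := column_chain_piece lW; have Pn := column_chain_piece nW.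
  rewrite no; case: (boolP (odd l)) => lo.
    have [|//|<- <-//] := copy_searrow Pn Pl.
    by rewrite /column_left /column_right no lo.
  have [|//|<- <-//] := copy_nearrow Pl Pn.
  by rewrite /column_left /column_right no (negbTE lo).
move=> kW; split; first by rewrite (step k kW).1.
have last_row : (height D).-1 = (2 * rows D + 1)%N by rewrite /height; lia.
suff all l : (l < height D)%N ->
  (if odd k then west (column_chain k) else east (column_chain k)) =
   (if odd ((k + l) %% height D) then west (column_chain ((k + l) %% height D))
     else east (column_chain ((k + l) %% height D))).
  have := all ((height D).-1 - k)%N; rewrite subnKC; last by lia.
  rewrite modn_small; last by lia.
  move=> ->; last by lia.
  rewrite last_row oddD oddM /= /column_chain /column_left /column_right oddD
    oddM /= /X mod0n /row_chain /row_bottom /row_top /=.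
  by rewrite /height addn1 addn2.
elim: l => [|l IH] lW; first by rewrite addn0 modn_small.
rewrite IH; last by lia.
have nW := ltn_pmod (k + l) HO.
by rewrite (step _ nW).2 -addn1 modnDml addn1 addnS.
Qed.

Let sides a b c d := [/\ west (copy a b c d) = X a, east (copy a b c d) = X b,
  south (copy a b c d) = Y c & north (copy a b c d) = Y d].

Lemma row_wall_west i : (i <= cols D)%N ->
  [/\ west (copy (2 * i + 1) (2 * i + 2) 0 1) = X (2 * i + 1),
      east (copy (2 * i + 1) (2 * i + 2) 0 1) = X (2 * i + 2)
    & south (copy (2 * i + 1) (2 * i + 2) 0 1) = Y 0%N].
Proof.
move=> hi; have kW : (2 * i + 1 < width D)%N by rewrite /width; lia.
have [] := row_chain_step kW; have := row_chain_west kW.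
by rewrite /row_chain /row_bottom /row_top oddD oddM /= !addn1 !addn2.
Qed.

Lemma upper_strip_sides i : (0 < i <= cols D)%N ->
  [/\ west (copy (2 * i) (2 * i + 1) (2 * high D i + 1) (height D)) = X (2 * i),
      east (copy (2 * i) (2 * i + 1) (2 * high D i + 1) (height D)) = X (2 * i + 1)
    & north (copy (2 * i) (2 * i + 1) (2 * high D i + 1) (height D)) = Y (height
      D)].
Proof.
move=> hi; have kW : (2 * i < width D)%N by rewrite /width; lia.
have [] := row_chain_step kW; have := row_chain_west kW.
have -> : (2 * i = i.*2)%N by lia.
have /negPf i0 : i.*2 != 0%N by lia.
by rewrite /row_chain /row_bottom /row_top odd_double i0 doubleK YN !addn1.
Qed.

Lemma column_wall_south j : (j <= rows D)%N ->
  [/\ south (copy 0 1 (2 * j + 1) (2 * j + 2)) = Y (2 * j + 1),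
      north (copy 0 1 (2 * j + 1) (2 * j + 2)) = Y (2 * j + 2)
    & west (copy 0 1 (2 * j + 1) (2 * j + 2)) = X 0%N].
Proof.
move=> hj; have kW : (2 * j + 1 < height D)%N by rewrite /height; lia.
have [] := column_chain_step kW; have := column_chain_south kW.
by rewrite /column_chain /column_left /column_right oddD oddM /= !addn1 !addn2.
Qed.

Lemma right_strip_sides j : (0 < j <= rows D)%N ->
  [/\ south (copy (2 * rightmost D j + 1) (width D) (2 * j) (2 * j + 1)) = Y (2 *
    j),
      north (copy (2 * rightmost D j + 1) (width D) (2 * j) (2 * j + 1)) = Y (2 *
        j + 1)
    & east (copy (2 * rightmost D j + 1) (width D) (2 * j) (2 * j + 1)) = X
      (width D)].
Proof.
move=> hj; have kW : (2 * j < height D)%N by rewrite /height; lia.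
have [] := column_chain_step kW; have := column_chain_south kW.
have -> : (2 * j = j.*2)%N by lia.
have /negPf j0 : j.*2 != 0%N by lia.
by rewrite /column_chain /column_left /column_right odd_double j0 doubleK XN !addn1.
Qed.

(** A lower strip touches the wall squares before and after it, which fixes its
    western and eastern sides and puts the three on a common longitude. *)
Lemma lower_strip_sides i : (0 < i <= cols D)%N ->
  [/\ west (copy (2 * i) (2 * i + 1) 1 (2 * low D i)) = X (2 * i),
      east (copy (2 * i) (2 * i + 1) 1 (2 * low D i)) = X (2 * i + 1),
      south (copy (2 * i) (2 * i + 1) 1 (2 * low D i)) =
        north (copy (2 * i.-1 + 1) (2 * i.-1 + 2) 0 1)
    & south (copy (2 * i) (2 * i + 1) 1 (2 * low D i)) =
        north (copy (2 * i + 1) (2 * i + 2) 0 1)].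
Proof.
move=> hi; have hi1 : (i.-1 <= cols D)%N by lia.
have hi' : (i <= cols D)%N by lia.
have iE : (2 * i.-1 + 2 = 2 * i)%N by lia.
have [_ east_w _] := row_wall_west hi1; have [west_w _ _] := row_wall_west hi'.
have [|//|e n] := copy_nearrow (row_wall hi1) (lower_strip hi); first by rewrite iE.
have [//|//|e' n'] := copy_searrow (lower_strip hi) (row_wall hi').
by split=> //; rewrite -?e ?east_w ?iE// e'.
Qed.

(** Descending induction: the last wall square belongs to the chain along the
    meridian 0, which defines [Y 1]. *)
Lemma row_wall_north i : (i <= cols D)%N ->
  north (copy (2 * i + 1) (2 * i + 2) 0 1) = Y 1.
Proof.
suff all l : (l <= cols D)%N ->
  north (copy (2 * (cols D - l) + 1) (2 * (cols D - l) + 2) 0 1) = Y 1.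
  by move=> hi; have := all (cols D - i)%N (leq_subr _ _); rewrite subKn.
elim: l => [_|l IH lc].
  have [+ _] := column_chain_step HO;
    rewrite subn0 /column_chain /column_left /column_right /= => <-.
  by rewrite /width.
rewrite -IH; last by lia.
have hi : (0 < cols D - l <= cols D)%N by lia.
have [_ _ s1 <-] := lower_strip_sides hi.
by have -> : (cols D - l.+1)%N = (cols D - l).-1 by lia.
Qed.

(** [lower_strip_sides] with the two factors exchanged. *)
Lemma left_strip_sides j : (0 < j <= rows D)%N ->
  [/\ south (copy 1 (2 * leftmost D j) (2 * j) (2 * j + 1)) = Y (2 * j),
      north (copy 1 (2 * leftmost D j) (2 * j) (2 * j + 1)) = Y (2 * j + 1),
      west (copy 1 (2 * leftmost D j) (2 * j) (2 * j + 1)) =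
        east (copy 0 1 (2 * j.-1 + 1) (2 * j.-1 + 2))
    & west (copy 1 (2 * leftmost D j) (2 * j) (2 * j + 1)) =
        east (copy 0 1 (2 * j + 1) (2 * j + 2))].
Proof.
move=> hj; have hj1 : (j.-1 <= rows D)%N by lia.
have hj' : (j <= rows D)%N by lia.
have jE : (2 * j.-1 + 2 = 2 * j)%N by lia.
have [_ north_w _] := column_wall_south hj1;
  have [south_w _ _] := column_wall_south hj'.
have [//||e n] := copy_nearrow (column_wall hj1) (left_strip hj);
  first by rewrite jE.
have [//|//|e' n'] := copy_searrow (column_wall hj') (left_strip hj).
by split=> //; rewrite -?n ?north_w ?jE// -n'.
Qed.

Lemma column_wall_east j : (j <= rows D)%N ->
  east (copy 0 1 (2 * j + 1) (2 * j + 2)) = X 1.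
Proof.
suff all l : (l <= rows D)%N ->
  east (copy 0 1 (2 * (rows D - l) + 1) (2 * (rows D - l) + 2)) = X 1.
  by move=> hj; have := all (rows D - j)%N (leq_subr _ _); rewrite subKn.
elim: l => [_|l IH lc].
  have [+ _] := row_chain_step WO;
    rewrite subn0 /row_chain /row_bottom /row_top /= => <-.
  by rewrite /height.
rewrite -IH; last by lia.
have hj : (0 < rows D - l <= rows D)%N by lia.
have [_ _ w1 <-] := left_strip_sides hj.
by have -> : (rows D - l.+1)%N = (rows D - l).-1 by lia.
Qed.

(** The end of a strip at a point of the link is traced through the strip of the
    other direction that it touches there: its line is known from that strip. *)
Lemma upper_strip_copy i : (0 < i <= cols D)%N ->
  sides (2 * i) (2 * i + 1) (2 * high D i + 1) (height D).
Proof.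
move=> hi; have [w e n] := upper_strip_sides hi; split=> //.
have [? ? ?] := low_high hi; have hj : (0 < high D i <= rows D)%N by lia.
have [//|il|ir] := (incidence hi hj).1; first by right.
  have [_ n' _ _] := left_strip_sides hj.
  by have [||_ <-//] := copy_nearrow (left_strip hj) (upper_strip hi); rewrite -?il.
have [_ n' _] := right_strip_sides hj.
by have [||_ ->//] := copy_searrow (upper_strip hi) (right_strip hj); rewrite -?ir.
Qed.

Lemma lower_strip_copy i : (0 < i <= cols D)%N ->
  sides (2 * i) (2 * i + 1) 1 (2 * low D i).
Proof.
move=> hi; have [w e s1 s2] := lower_strip_sides hi; split=> //.
  by rewrite s2 row_wall_north//; lia.
have [? ? ?] := low_high hi; have hj : (0 < low D i <= rows D)%N by lia.
have [//|il|ir] := (incidence hi hj).1; first by left.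
  have [s' _ _ _] := left_strip_sides hj.
  by have [||_ <-//] := copy_searrow (left_strip hj) (lower_strip hi); rewrite -?il.
have [s' _ _] := right_strip_sides hj.
by have [||_ ->//] := copy_nearrow (lower_strip hi) (right_strip hj); rewrite -?ir.
Qed.

Lemma right_strip_copy j : (0 < j <= rows D)%N ->
  sides (2 * rightmost D j + 1) (width D) (2 * j) (2 * j + 1).
Proof.
move=> hj; have [s n e] := right_strip_sides hj; split=> //.
have [? ? ?] := left_right hj; have hi : (0 < rightmost D j <= cols D)%N by lia.
have [//|jl|jh] := (incidence hi hj).2; first by right.
  have [_ e' _ _] := lower_strip_copy hi.
  by have [||<- _//] := copy_nearrow (lower_strip hi) (right_strip hj);
    rewrite -?jl.
have [_ e' _ _] := upper_strip_copy hi.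
by have [||<- _//] := copy_searrow (upper_strip hi) (right_strip hj); rewrite -?jh.
Qed.

Lemma left_strip_copy j : (0 < j <= rows D)%N ->
  sides 1 (2 * leftmost D j) (2 * j) (2 * j + 1).
Proof.
move=> hj; have [s n w1 w2] := left_strip_sides hj; split=> //.
  by rewrite w2 column_wall_east//; lia.
have [? ? ?] := left_right hj; have hi : (0 < leftmost D j <= cols D)%N by lia.
have [//|jl|jh] := (incidence hi hj).2; first by left.
  have [w' _ _ _] := lower_strip_copy hi.
  by have [||-> _//] := copy_searrow (left_strip hj) (lower_strip hi); rewrite -?jl.
have [w' _ _ _] := upper_strip_copy hi.
by have [||-> _//] := copy_nearrow (left_strip hj) (upper_strip hi); rewrite -?jh.
Qed.

Lemma copy_sides a b c d : piece D a b c d -> sides a b c d.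
Proof.
case=> [i hi|j hj|i hi|i hi|j hj|j hj].
- by have [w e s] := row_wall_west hi; split=> //; exact: row_wall_north.
- by have [s n w] := column_wall_south hj; split=> //; exact: column_wall_east.
- exact: upper_strip_copy.
- exact: lower_strip_copy.
- exact: right_strip_copy.
- exact: left_strip_copy.
Qed.

Lemma row_chain_lift :
  exists v, turn_once (width D) v /\ forall k, (k <= width D)%N ->
    to_circle (v k) = X k.
Proof.
have [//|//|k kW|k l kW lW kl|v [v_turn vX]] := @chain_turns_once R (width D) X.
- have [e _] := row_chain_step kW; rewrite -(row_chain_west kW) -e.
  by have /is_rectangleP[] := copy_rectangle (row_chain_piece kW).
- have [ek yk] := row_chain_step kW; have [el yl] := row_chain_step lW.
  rewrite -(row_chain_west kW) -(row_chain_west lW) -ek -el.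
  apply: (longitude_arcs (y := Y 0%N)).
  + exact: copy_rectangle (row_chain_piece kW).
  + exact: copy_rectangle (row_chain_piece lW).
  + by apply: copy_compatible; [exact: row_chain_piece|exact: row_chain_piece|case].
  + by rewrite -yk; case: odd; [left|right].
  + by rewrite -yl; case: odd; [left|right].
exists v; split=> // k; rewrite leq_eqVlt => /predU1P[->|]; last exact: vX.
by rewrite (mark_N v_turn) vX.
Qed.

Lemma column_chain_lift :
  exists v, turn_once (height D) v /\ forall k, (k <= height D)%N ->
    to_circle (v k) = Y k.
Proof.
have [//|//|k kW|k l kW lW kl|v [v_turn vY]] := @chain_turns_once R (height D) Y.
- have [e _] := column_chain_step kW; rewrite -(column_chain_south kW) -e.
  by have /is_rectangleP[] := copy_rectangle (column_chain_piece kW).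
- have [ek yk] := column_chain_step kW; have [el yl] := column_chain_step lW.
  rewrite -(column_chain_south kW) -(column_chain_south lW) -ek -el.
  apply: (meridian_arcs (x := X 0%N)).
  + exact: copy_rectangle (column_chain_piece kW).
  + exact: copy_rectangle (column_chain_piece lW).
  + by apply: copy_compatible;
      [exact: column_chain_piece|exact: column_chain_piece|case].
  + by rewrite -yk; case: odd; [left|right].
  + by rewrite -yl; case: odd; [left|right].
exists v; split=> // k; rewrite leq_eqVlt => /predU1P[->|]; last exact: vY.
by rewrite (mark_N v_turn) vY.
Qed.

Lemma surface_rigid : combinatorially_equivalent (surface D x y) P'.
Proof.
have [u [u_turn uX]] := row_chain_lift; have [v [v_turn vY]] := column_chain_lift.
have [f [f_homeo fE f_arc]] := exists_homeo_through WO x_turn u_turn.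
have [g [g_homeo gE g_arc]] := exists_homeo_through HO y_turn v_turn.
have fX k : (k <= width D)%N -> f (to_circle (x k)) = X k.
  by move=> kW; rewrite -uX// fE.
have gY k : (k <= height D)%N -> g (to_circle (y k)) = Y k.
  by move=> kH; rewrite -vY// gE.
exists f, g; split=> //.
have image_tile a b c d : piece D a b c d ->
    (fun p : torus R => (f p.1, g p.2)) @` tile x y a b c d = copy a b c d.
  move=> P; have [ab bW _ [cd dH _]] := piece_bounds P.
  have [nx ny _] := tile_rectangle x_turn y_turn P.
  have /is_rectangleP[_ _ ->] := copy_rectangle P;
    have [-> -> -> ->] := copy_sides P.
  rewrite -!fX; [|lia|lia]; rewrite -!gY; [|lia|lia]; rewrite -f_arc// -g_arc//.
  apply/seteqP; split=> [_ [[p1 p2] [/= h1 h2] <-]|[q1 q2] [/= [p1 h1 <-]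
    [p2 h2 <-]]].
    by split; [exists p1|exists p2].
  by exists (p1, p2).
case: phi_bij => phi_P' _ phi_surj; apply/seteqP; split=> r.
  move=> [_ [a [b [c [d [P ->]]]]] <-]; rewrite image_tile//; exact: copy_in.
move=> /phi_surj[_ [a [b [c [d [P ->]]]]] <-].
by exists (tile x y a b c d); [exact: piece_surface|rewrite image_tile].
Qed.

End rigidity.

(** * From a link to a pattern *)

Section link.
Context {R : realType}.

(** Lifting [T] to the interval from 0 to 1 and starting the turn slightly before
    0, but after the last lift minus 1, gives a start outside [T]. *)
Lemma finite_marks (T : set (circle R)) : finite_set T ->
  exists (n : nat) (u : nat -> R), turn_once n.+1 u /\
    forall t, T t <-> exists i, (0 < i <= n)%N /\ t = to_circle (u i).
Proof.
move=> /finite_seqP[s ->].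
have /choice[lift liftP] (t : circle R) : exists r : R, to_circle r = t /\ 0 <= r
  < 1.
  by have [r rt] := lift_circle 0 t; rewrite add0r; exists r.
pose v := sort <=%R (undup (map lift s)).
have v01 r : r \in v -> 0 <= r < 1.
  by rewrite mem_sort mem_undup => /mapP[t _ ->]; exact: (liftP t).2.
have [base base0 vo] : exists2 base : R, base < 0 & {in v, forall r, r < base + 1}.
  elim: v v01 => [|a v' IH] v01; first by exists (-1); rewrite ?ltrN10.
  have [|base base0 vo] := IH; first by move=> r rv; apply: v01;
    rewrite inE rv orbT.
  have /andP[a0 a1] := v01 a (mem_head _ _).
  exists (Num.max base ((a - 1) / 2)); first by rewrite gt_max base0; lra.
  move=> r; rewrite inE => /predU1P[->|/vo ro].
    have : (a - 1) / 2 <= Num.max base ((a - 1) / 2) by rewrite le_max lexx orbT.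
    by lra.
  have : base <= Num.max base ((a - 1) / 2) by rewrite le_max lexx.
  by lra.
have v_path : path <%R base v.
  have v_sorted : sorted <%R v.
    by rewrite lt_sorted_uniq_le sort_uniq undup_uniq sort_le_sorted.
  rewrite path_min_sorted//; apply/allP => r /v01 /andP[r0 _].
  exact: lt_le_trans r0.
pose u i := nth (base + 1) (base :: v) i.
exists (size v), u; split.
  split=> [i|]; last by rewrite /u /= nth_default.
  rewrite ltnS leq_eqVlt => /predU1P[->|iv]; last first.
    by have /(pathP (base + 1)) := v_path; apply.
  have : u (size v) \in base :: v by rewrite mem_nth.
  have -> : u (size v).+1 = base + 1 by rewrite /u /= nth_default.
  by rewrite inE => /predU1P[->|/vo//]; rewrite ltrDl.
move=> t; split=> [ts|[[|i] [iv ->]]] //.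
  have rv : lift t \in v by rewrite mem_sort mem_undup map_f.
  exists (index (lift t) v).+1; split; first by rewrite ltnS index_mem.
  by rewrite /u /= nth_index// (liftP t).1.
have : u i.+1 \in v by rewrite /u /= mem_nth.
by rewrite mem_sort mem_undup => /mapP[t' ts ->]; rewrite (liftP t').1.
Qed.

(** Each [u i] is doubled by a new mark at a third of the distance to the next or
    to the previous one, so that new marks from both sides do not collide. The
    marks 0 and n + 1 are the cut, where the new mark must come after. *)
Lemma doubled_marks n (u : nat -> R) (upper : nat -> bool) : turn_once n.+1 u ->
  exists x, turn_once (2 * n + 2) x /\
    forall i, (0 < i <= n)%N -> x (2 * i + upper i)%N = u i.
Proof.
move=> [u_mono uN]; pose e i := upper i && (0 < i <= n)%N.
pose x k := let i := k./2 in
  if odd k == e i then u i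
  else if odd k then (2 * u i + u i.+1) / 3 else (2 * u i + u i.-1) / 3.
have x_lo i : x (2 * i)%N = if e i then (2 * u i + u i.-1) / 3 else u i.
  by rewrite /x mul2n odd_double doubleK; case: (e i).
have x_hi i : x (2 * i + 1)%N = if e i then u i else (2 * u i + u i.+1) / 3.
  by rewrite /x mul2n addn1 /= odd_double uphalf_double; case: (e i).
exists x; split; first split.
- move=> k kn; have := odd_double_half k; set i := k./2.
  have step := u_mono i; case: (odd k) => kE.
    have -> : k = (2 * i + 1)%N by lia.
    have -> : (2 * i + 1).+1 = (2 * i.+1)%N by lia.
    have {}step := step ltac:(lia).
    by rewrite x_hi x_lo /=; case: (e i); case: (e i.+1); lra.
  have -> : k = (2 * i)%N by lia.
  rewrite -[(2 * i).+1]addn1 x_hi x_lo; have {}step := step ltac:(lia).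
  case ei: (e i); last by lra.
  have i0 : (0 < i)%N by move: ei; rewrite /e => /and3P[].
  have := u_mono i.-1; rewrite prednK// => /(_ ltac:(lia)); lra.
- have -> : (2 * n + 2 = 2 * n.+1)%N by lia.
  have -> : x 0%N = u 0%N by rewrite -[0%N]/(2 * 0)%N x_lo /e andbF.
  by rewrite x_lo /e ltnn !andbF.
- move=> i hi; case ui: (upper i); rewrite ?addn0.
    by rewrite x_hi /e ui hi.
  by rewrite x_lo /e ui.
Qed.

Lemma card2_pair (T : choiceType) (A : set T) : A #= `I_2 ->
  exists p q, p <> q /\ forall r, A r <-> r = p \/ r = q.
Proof.
move=> A2; have A_fin : finite_set A.
  by apply/finite_setP; exists 2%N.
have := card_fset_set A2; have memA := in_fset_set A_fin.
have := fset_uniq (fset_set A).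
move: memA; set s := enum_fset _ => memA.
have {}memA r : A r <-> r \in s.
  by rewrite memA; split; [move/mem_set|move/set_mem].
case: s memA => [|p [|q []]]//= memA; rewrite inE andbT => /eqP pq _.
exists p, q; split=> // r; rewrite memA !inE.
by split=> [/orP[]/eqP ->|[]->]; rewrite ?eqxx ?orbT; auto.
Qed.

(** The two points of the link on a line, as indices in increasing order. *)
Lemma two_indices (T : choiceType) (A : set T) m (c : nat -> T) : A #= `I_2 ->
  (forall p, A p -> exists j, (0 < j <= m)%N /\ p = c j) ->
  (forall i j, (0 < i <= m)%N -> (0 < j <= m)%N -> c i = c j -> i = j) ->
  exists lh : nat * nat, [/\ (0 < lh.1)%N, (lh.1 < lh.2)%N, (lh.2 <= m)%N
    & forall j, (0 < j <= m)%N -> A (c j) <-> j = lh.1 \/ j = lh.2].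
Proof.
move=> /card2_pair[p [q [pq AE]]] A_c c_inj.
have [|j [jm pE]] := A_c p; first by apply/AE; left.
have [|k [km qE]] := A_c q; first by apply/AE; right.
have jk : j <> k by move=> e; apply: pq; rewrite pE qE e.
have mem i : (0 < i <= m)%N -> A (c i) <-> i = j \/ i = k.
  move=> im; rewrite AE pE qE; split=> [[]/(c_inj _ _ im) e|[]->];
    [| |by left|by right].
    by left; exact: e.
  by right; exact: e.
case: (ltngtP j k) => // lt; [exists (j, k)|exists (k, j)]; split=> //=; try lia.
by move=> i /mem ->; split; case; auto.
Qed.

Lemma turn_once_inj n (u : nat -> R) i j : turn_once n.+1 u ->
  (0 < i <= n)%N -> (0 < j <= n)%N -> to_circle (u i) = to_circle (u j) -> i = j.
Proof. by move=> ut hi hj; apply: (mark_inj ut); lia. Qed.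

End link.

Theorem lemma5p1 (R : realType) (L : set (torus R)) (sgn : torus R -> bool)
    (hL : is_link_diagram L sgn) :
  exists P : set (set (torus R)),
    [/\ is_surface_diagram P,
        L `<=` boundary P
      & forall P' : set (set (torus R)),
          is_surface_diagram P' -> same_dividing_code P P' ->
          combinatorially_equivalent P P'].
Proof.
case: hL => L_fin L_mer L_lon L_sgn.
have [n [th [th_turn thP]]] := finite_marks (finite_image fst L_fin).
have [m [ph [ph_turn phP]]] := finite_marks (finite_image snd L_fin).
pose pt i j : torus R := (to_circle (th i), to_circle (ph j)).
have L_pt p : L p -> exists i j, [/\ (0 < i <= n)%N, (0 < j <= m)%N & p = pt i j].
  move=> Lp; have [|i [hi pi]] := (thP p.1).1; first by exists p.
  have [|j [hj pj]] := (phP p.2).1; first by exists p.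
  by exists i, j; split=> //; case: p {Lp} pi pj => p1 p2 /= -> ->.
have /choice[lh lhP] i : exists lh : nat * nat, (0 < i <= n)%N ->
    [/\ (0 < lh.1)%N, (lh.1 < lh.2)%N, (lh.2 <= m)%N
      & forall j, (0 < j <= m)%N -> L (pt i j) <-> j = lh.1 \/ j = lh.2].
  have [hi|?] := boolP (0 < i <= n)%N; last by exists (0, 0)%N.
  have [e|c2] := L_mer (to_circle (th i)).
    have [p Lp pE] := (thP (to_circle (th i))).2 (ex_intro _ i (conj hi erefl)).
    by have : (meridian (to_circle (th i)) `&` L) p by []; rewrite e.
  have [||lh [? ? ? lhP]] := two_indices (m := m) (c := pt i) c2.
  - move=> p [[pi _] /L_pt[i' [j [_ hj pE]]]]; exists j; split=> //.
    by move: pi; rewrite pE /pt /= => ->.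
  - by move=> j j' hj hj' [/(turn_once_inj ph_turn hj hj')].
  exists lh => _; split=> // j /lhP <-; split=> [Lp|[]//]; split=> //.
have /choice[lr lrP] j : exists lr : nat * nat, (0 < j <= m)%N ->
    [/\ (0 < lr.1)%N, (lr.1 < lr.2)%N, (lr.2 <= n)%N
      & forall i, (0 < i <= n)%N -> L (pt i j) <-> i = lr.1 \/ i = lr.2].
  have [hj|?] := boolP (0 < j <= m)%N; last by exists (0, 0)%N.
  have [e|c2] := L_lon (to_circle (ph j)).
    have [p Lp pE] := (phP (to_circle (ph j))).2 (ex_intro _ j (conj hj erefl)).
    by have : (longitude (to_circle (ph j)) `&` L) p by []; rewrite e.
  have [||lr [? ? ? lrP]] := two_indices (m := n) (c := pt ^~ j) c2.
  - move=> p [[_ pj] /L_pt[i [j' [hi _ pE]]]]; exists i; split=> //.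
    by move: pj; rewrite pE /pt /= => ->.
  - by move=> i i' hi hi' [/(turn_once_inj th_turn hi hi')].
  exists lr => _; split=> // i /lrP <-; split=> [Lp|[]//]; split=> //.
have [D [cD rD lowD [highD [leftD rightD]]]] : exists D : pattern,
  [/\ cols D = n, rows D = m, low D = fst \o lh
    & high D = snd \o lh /\ (leftmost D = fst \o lr /\ rightmost D = snd \o lr)].
  unshelve eexists (@Pattern n m (fst \o lh) (snd \o lh) (fst \o lr) (snd \o lr)
    _ _ _).
  - by move=> i /lhP[].
  - by move=> j /lrP[].
  - move=> i j hi hj /=; have [_ _ _ <-//] := lhP i hi;
      by have [_ _ _ <-] := lrP j hj.
  - by [].
have [x [x_turn xE]] := doubled_marks (fun i => sgn (pt i (lh i).1)) th_turn.
have [y [y_turn yE]] := doubled_marks (fun j => ~~ sgn (pt (lr j).1 j)) ph_turn.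
rewrite -{1}cD in x_turn; rewrite -{1}rD in y_turn.
exists (surface D x y); split.
- exact: surface_diagram.
- move=> p Lp; have [i [j [hi hj pE]]] := L_pt p Lp.
  apply/(surface_boundaryP x_turn y_turn).
  rewrite pE in Lp *; have [low0 lowhigh highm lowP] := lhP i hi.
  have [left0 leftright rightn leftP] := lrP j hj.
  exists i, j, (2 * i + sgn (pt i (lh i).1))%N, (2 * j + ~~ sgn (pt (lr j).1 j))%N.
  split; last by rewrite xE// yE.
  have jE := (lowP j hj).1 Lp; have iE := (leftP i hi).1 Lp.
  split; rewrite ?cD ?rD ?lowD ?highD ?leftD ?rightD //=.
  + by case: (sgn _); lia.
  + by case: (sgn _); lia.
  (* signs alternate along a column, and along a row *)
  have sgn_i : sgn (pt i (lh i).1) = (j == (lh i).1) (+) ~~ sgn (pt i j).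
    case: eqVneq => [->|neq]; first by rewrite /= negbK.
    have L' : L (pt i (lh i).1) by apply/lowP; [lia|left].
    have : sgn (pt i j) <> sgn (pt i (lh i).1).
      apply: L_sgn => //; [|by left].
      case=> /(turn_once_inj ph_turn hj) e.
      by case/eqP: neq; apply: e; lia.
    by case: (sgn _); case: (sgn _).
  have sgn_j : sgn (pt (lr j).1 j) = (i == (lr j).1) (+) ~~ sgn (pt i j).
    case: eqVneq => [->|neq]; first by rewrite /= negbK.
    have L' : L (pt (lr j).1 j) by apply/leftP; [lia|left].
    have : sgn (pt i j) <> sgn (pt (lr j).1 j).
      apply: L_sgn => //; [|by right].
      case=> /(turn_once_inj th_turn hi) e.
      by case/eqP: neq; apply: e; lia.
    by case: (sgn _); case: (sgn _).
  rewrite sgn_i sgn_j; case: (j == _); case: (i == _); case: (sgn _) => /=; lia.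
- move=> P' P'_surface [phi [phi_bij phi_ne phi_se]].
  exact: (surface_rigid x_turn y_turn P'_surface phi_bij phi_ne phi_se).
Qed.
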